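(* Let $n\ge3$ be odd and let $K$ be an $n$-dimensional indecomposable exp-maximal minimal cone whose extreme vectors $x_1,\ldots,x_{n+1}$ satisfy the relation $$x_1+x_3+\cdots+x_{n-2}+x_n=x_2+x_4+\cdots+x_{n-1}+x_{n+1}.$$ For every $\alpha>0$, let $A_\alpha$ be the exp-maximal $K$-primitive matrix given by $$A_\alpha x_1=(1+\alpha)x_2,\qquad A_\alpha x_i=x_{i+1}\ (2\le i\le n),\qquad A_\alpha x_{n+1}=x_1+\alpha x_2.$$ Then: (i) $\Phi(A_\alpha)$ is a $2$-dimensional face of $\pi(K)$, independent of the choice of the positive scalar $\alpha$; its relative interior consists of positive multiples of matrices of the form $A_{\tilde\alpha}$, $\tilde\alpha>0$. (ii) Every exp-maximal $K$-primitive matrix is cone-equivalent to a positive multiple of some $A_\alpha$ and thus is a positive multiple of a matrix of the form $P_\sigma^{-1}A_\alpha P_\sigma$, where $P_\sigma$ is the automorphism of $K$ given by $P_\sigma x_j=x_{\sigma(j)}$ for $j=1,\ldots,n+1$, $\sigma$ being a permutation of $\{1,\ldots,n+1\}$ that maps $\{1,3,\ldots,n-2,n\}$ onto itself or onto $\{2,4,\ldots,n-1,n+1\}$. (iii) For distinct positive scalars $\alpha_1,\alpha_2$, $A_{\alpha_1}$ and $A_{\alpha_2}$, or their positive multiples, are not cone-equivalent.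
   Context: A proper cone is a closed, pointed ($K\cap(-K)=\{0\}$) convex cone with nonempty interior. A face of a cone $K$ is a subcone $F\subseteq K$ such that $y\in F$ whenever $x\in F$ and $y,x-y\in K$; $\Phi(x)$ is the smallest face of the cone containing $x$. A nonzero $x\in K$ is an extreme vector if $\Phi(x)=\{\lambda x:\lambda\ge0\}$ (an extreme ray). A polyhedral cone is a proper cone with finitely many extreme rays; $\mathcal{P}(m,n)$ is the set of $n$-dimensional polyhedral cones with exactly $m$ extreme rays. An $n$-dimensional minimal cone is a member of $\mathcal{P}(n+1,n)$; its extreme vectors satisfy a unique nonzero linear relation up to multiples. A cone is indecomposable if it is not the direct sum of two nonzero subcones. $\pi(K)$, the set of real matrices $A$ with $AK\subseteq K$, is itself a proper cone in the space of $n\times n$ real matrices, and $\Phi(A)$ for $A\in\pi(K)$ is the face of $\pi(K)$ generated by $A$. $A\in\pi(K)$ is $K$-primitive if $A^p(K\setminus\{0\})\subseteq\operatorname{int}K$ for some positive integer $p$; the least such $p$ is the exponent $\gamma(A)$. For polyhedral $K$, $\gamma(K)=\max\{\gamma(A):A\text{ is }K\text{-primitive}\}$; a $K$-primitive $A$ is exp-maximal if $\gamma(A)=\gamma(K)$; $K_0\in\mathcal{P}(m,n)$ is exp-maximal if $\gamma(K_0)=\max\{\gamma(K):K\in\mathcal{P}(m,n)\}$. $A_1\in\pi(K_1)$ and $A_2\in\pi(K_2)$ are cone-equivalent if there is a linear isomorphism $P$ with $PK_2=K_1$ and $P^{-1}A_1P=A_2$. An automorphism of $K$ is an invertible matrix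 $P$ with $PK=K$. *)

(* Defs.v *)
From HB Require Import structures.
From mathcomp Require Import all_boot all_order all_algebra all_fingroup.
From mathcomp Require Import all_classical all_reals all_analysis.

Set Implicit Arguments.
Unset Strict Implicit.
Unset Printing Implicit Defensive.

Import Order.TTheory GRing.Theory Num.Theory.
Import numFieldNormedType.Exports.

Local Open Scope classical_set_scope.
Local Open Scope ring_scope.

Section ConvexCones.
Context {R : realType} {V : lmodType R}.
Implicit Types (K F : set V) (x : V).

Definition convex_cone K : Prop :=
  [/\ K 0,
      forall x y, K x -> K y -> K (x + y)
    & forall (a : R) x, 0 <= a -> K x -> K (a *: x)].

Definition subcone F K : Prop := convex_cone F /\ F `<=` K.

Definition face K F : Prop :=
  subcone F K /\ forall x y, F x -> K y -> K (x - y) -> F y.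

Definition Phi K x : set V := smallest (face K) [set x].

Definition ray x : set V := [set a *: x | a in [set a : R | 0 <= a]].

Definition extreme_vector K x : Prop := [/\ K x, x != 0 & Phi K x = ray x].

Definition extreme_rays K : set (set V) := ray @` extreme_vector K.

End ConvexCones.

Section LinearSpan.
Context {R : realType} {V : vectType R}.
Implicit Types (S K : set V).

Definition linspan S : set V :=
  [set v | forall U : {vspace V}, S `<=` [set` U] -> v \in U].

(* The dimension of a cone is that of its linear span. *)
Definition has_dim S (d : nat) : Prop :=
  exists2 U : {vspace V}, [set` U] = linspan S & \dim U = d.

Definition direct_sum K1 K2 K : Prop :=
  [set u + v | u in K1 & v in K2] = K /\
  linspan K1 `&` linspan K2 = [set 0].

Definition indecomposable K : Prop :=
  ~ exists K1 K2 : set V,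
      [/\ subcone K1 K, subcone K2 K, K1 <> [set 0], K2 <> [set 0]
        & direct_sum K1 K2 K].

End LinearSpan.

(* The interior relative to the linear span, which for a cone is also its
   affine hull. *)
Definition relint {R : realType} {m n : nat} (S : set 'M[R]_(m, n)) :
    set 'M[R]_(m, n) :=
  [set M | S M /\ \forall N \near M, linspan S N -> S N].

Section PolyhedralCones.
Context {R : realType} {n : nat}.
Implicit Types (K : set 'cV[R]_n) (A P : 'M[R]_n).

Definition proper_cone K : Prop :=
  [/\ convex_cone K, closed K,
      K `&` [set - x | x in K] = [set 0] & K° !=set0].

(* Membership in P(m, n). *)
Definition polyhedral_cone (m : nat) K : Prop :=
  proper_cone K /\ (extreme_rays K #= `I_m)%card.

Definition minimal_cone K : Prop := polyhedral_cone n.+1 K.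

(* x lists the extreme vectors of K, exactly one on each extreme ray. *)
Definition lists_extreme_vectors (m : nat) K (x : 'I_m -> 'cV[R]_n) : Prop :=
  (forall i, extreme_vector K (x i)) /\
  (forall y, extreme_vector K y -> exists! i, ray y = ray (x i)).

Definition mx_image A K : set 'cV[R]_n := [set A *m x | x in K].

Definition pi_cone K : set 'M[R]_n := [set A | mx_image A K `<=` K].

Definition maps_to_interior K A : Prop := mx_image A (K `\ 0) `<=` K°.

Definition primitive K A : Prop :=
  pi_cone K A /\ exists2 p : nat, (0 < p)%N & maps_to_interior K (A ^+ p).

(* gamma(A) = g *)
Definition mx_exponent K A (g : nat) : Prop :=
  [/\ primitive K A, (0 < g)%N, maps_to_interior K (A ^+ g)
    & forall p : nat, (0 < p)%N -> maps_to_interior K (A ^+ p) -> (g <= p)%N].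

(* gamma(K) = g, the maximum being attained *)
Definition cone_exponent K (g : nat) : Prop :=
  (exists A, mx_exponent K A g) /\
  (forall A h, mx_exponent K A h -> (h <= g)%N).

Definition exp_maximal_mx K A : Prop :=
  exists2 g : nat, mx_exponent K A g & cone_exponent K g.

(* K is exp-maximal in P(m, n). *)
Definition exp_maximal_cone (m : nat) K : Prop :=
  polyhedral_cone m K /\
  exists2 g : nat, cone_exponent K g &
    forall (L : set 'cV[R]_n) (h : nat),
      polyhedral_cone m L -> cone_exponent L h -> (h <= g)%N.

Definition cone_equivalent K1 A1 K2 A2 : Prop :=
  [/\ pi_cone K1 A1, pi_cone K2 A2
    & exists P, [/\ P \in unitmx, mx_image P K2 = K1
                  & invmx P *m A1 *m P = A2]].

Definition automorphism K P : Prop := P \in unitmx /\ mx_image P K = K.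

End PolyhedralCones.

(* The vectors x_1, ..., x_(n+1) are x 0, ..., x n: index i stands for i + 1,
   so the odd-numbered vectors are those with i even. *)
Definition odd_numbered (n : nat) : {set 'I_n.+1} :=
  [set i : 'I_n.+1 | ~~ odd i]%SET.

Definition even_numbered (n : nat) : {set 'I_n.+1} :=
  [set i : 'I_n.+1 | odd i]%SET.

Definition alternating_relation {R : realType} {n : nat}
    (x : 'I_n.+1 -> 'cV[R]_n) : Prop :=
  \sum_(i in odd_numbered n) x i = \sum_(i in even_numbered n) x i.

Definition is_A_alpha {R : realType} {n : nat} (x : 'I_n.+1 -> 'cV[R]_n)
    (alpha : R) (A : 'M[R]_n) : Prop :=
  [/\ A *m x ord0 = (1 + alpha) *: x (inord 1),
      forall i : 'I_n.+1, (0 < i < n)%N -> A *m x i = x (inord i.+1)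
    & A *m x ord_max = x ord0 + alpha *: x (inord 1)].

(* Main.v *)
Require Import Defs.
From HB Require Import structures.
From mathcomp Require Import all_boot all_order all_algebra all_fingroup.
From mathcomp Require Import all_classical all_reals all_analysis.
From mathcomp Require Import ring zify.

Set Implicit Arguments.
Unset Strict Implicit.
Unset Printing Implicit Defensive.

Import Order.TTheory GRing.Theory Num.Theory.
Import numFieldNormedType.Exports.

Local Open Scope classical_set_scope.
Local Open Scope ring_scope.

(* Write s_i = (-1)^i, so that the relation is sum_i s_i x_i = 0 and the facets of
   K are the sums of two coordinates of opposite parities.  If a walk of length l
   in the digraph of a K-primitive B on the n + 1 extreme rays returns to u, the
   faces generated by u, B^l u, B^(2l) u, ... strictly increase, so B^(l(n-1)) u is
   interior.  A vertex reaches some circuit of length l <= n in i <= n + 1 - l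
   steps, hence gamma(B) <= n(n-1) + 1, and B^(n(n-1)) u on the boundary forces
   i = 1, l = n for every such circuit; then the digraph consists of a Hamiltonian
   circuit u = w_0 -> w_1 -> ... -> w_n -> w_0 and the chord w_n -> w_1.  Applying B
   to the relation shows that the signs alternate along this circuit and determines
   the coefficients of B: it is a multiple of a conjugate of some A_alpha.
   Conversely A_alpha^(n+1) = alpha A_alpha + (1 + alpha), which gives primitivity,
   the lower bound on the exponent, and the similarity invariants
   alpha c^n, (1 + alpha) c^(n+1) of c A_alpha that separate the A_alpha. *)

(** * Minkowski's theorem for cones *)

Section Minkowski.
Context {R : realType} {n : nat} (K : set 'cV[R]_n).
Hypotheses (Kcone : convex_cone K) (Kclosed : closed K).
Hypothesis Kpointed : K `&` [set - x | x in K] = [set 0].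

Lemma closed_half_line (y z : 'cV[R]_n) :
  (forall e : R, 0 < e -> K (y + e *: z)) -> K y.
Proof.
move=> Kyz.
have cv : (y + (harmonic k : R) *: z) @[k --> \oo] --> y.
  rewrite -[X in _ --> X]addr0; apply: cvgD; first exact: cvg_cst.
  by rewrite -[X in _ --> X](scale0r z); apply: cvgZr_tmp; exact: cvg_harmonic.
apply: (@closed_cvg _ _ _ _ _ K Kclosed _ _ cv); apply: nearW => k.
by apply: Kyz; rewrite /harmonic /= invr_gt0 ltr0n.
Qed.

Lemma pointed_eq0 (v : 'cV[R]_n) : K v -> K (- v) -> v = 0.
Proof.
move=> Kv KNv; have : (K `&` [set - x | x in K]) v.
  by split=> //; exists (- v) => //; rewrite opprK.
by rewrite Kpointed.
Qed.

(** The step is a supremum: if arbitrarily long steps stayed in [K], rescaling and closedness would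
    put [- z] in [K], against pointedness. *)
Lemma exists_max_step (y z : 'cV[R]_n) : K y -> K z -> z != 0 ->
  exists t : R, [/\ 0 <= t, K (y - t *: z)
    & forall e, 0 < e -> ~ K (y - t *: z - e *: z)].
Proof.
have [K0 KD KZ] := Kcone.
move=> Ky Kz z0.
pose S := [set t : R | 0 <= t /\ K (y - t *: z)].
have S0 : S 0 by split=> //; rewrite scale0r subr0.
have down (s t : R) : s <= t -> S t -> K (y - s *: z).
  move=> st [t0 Kt]; have -> : y - s *: z = (y - t *: z) + (t - s) *: z.
    by rewrite scalerBl addrA subrK.
  by apply: KD => //; apply: KZ; rewrite ?subr_ge0.
have Sub : has_ubound S.
  apply: contrapT => nub; case/negP: z0; apply/eqP/pointed_eq0 => //.
  apply: (@closed_half_line _ y) => e e0.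
  have [t St et] : exists2 t, S t & e^-1 < t.
    apply: contrapT => h; apply: nub; exists e^-1 => t St.
    by rewrite leNgt; apply/negP => ?; apply: h; exists t.
  have -> : - z + e *: y = e *: (y - e^-1 *: z).
    by rewrite scalerBr scalerA divff ?gt_eqF // scale1r addrC.
  by apply: KZ; [exact: ltW | apply: down (ltW et) St].
have supS : has_sup S by split=> //; exists 0.
exists (sup S); split.
- exact: ub_le_sup.
- apply: (@closed_half_line _ z) => e e0.
  have [t St et] := sup_adherent e0 supS.
  have -> : y - sup S *: z + e *: z = y - (sup S - e) *: z.
    by rewrite scalerBl opprB addrA addrAC.
  exact: down (ltW et) St.
- move=> e e0 h; have : S (sup S + e).
    split; first by apply: addr_ge0; [exact: ub_le_sup | exact: ltW].
    by rewrite scalerDl opprD addrA.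
  by move/(ub_le_sup Sub); rewrite gerDl leNgt e0.
Qed.

(** For [y] in [K] this is the linear span of the face [Phi K y]. *)
Definition lineality (y : 'cV[R]_n) : set 'cV[R]_n :=
  [set v | exists2 e : R, 0 < e & K (y + e *: v) /\ K (y - e *: v)].

Lemma lineality0 y : K y -> lineality y 0.
Proof. by move=> Ky; exists 1 => //; rewrite scaler0 addr0 subr0. Qed.

Lemma linealityD y u v : lineality y u -> lineality y v -> lineality y (u + v).
Proof.
have [K0 KD KZ] := Kcone.
move=> [d d0 [Kud Kud']] [e e0 [Kve Kve']].
have de0 : 0 < d + e by rewrite addr_gt0.
exists (d * e / (d + e)); first by rewrite divr_gt0 ?mulr_gt0.
have comb (p q : 'cV[R]_n) : K (y + d *: p) -> K (y + e *: q) ->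
    K (y + (d * e / (d + e)) *: (p + q)).
  move=> Kp Kq.
  have -> : y + (d * e / (d + e)) *: (p + q) =
      (e / (d + e)) *: (y + d *: p) + (d / (d + e)) *: (y + e *: q).
    rewrite !scalerDr !scalerA addrACA -scalerDl -mulrDl [e + d]addrC divff ?gt_eqF//.
    by rewrite scale1r; congr (_ + (_ *: _ + _ *: _)); ring.
  by apply: KD; apply: KZ => //; rewrite divr_ge0 ?ltW.
split; first exact: comb.
have := @comb (- u) (- v); rewrite -opprD !scalerN; exact.
Qed.

Lemma linealityZ y a v : K y -> lineality y v -> lineality y (a *: v).
Proof.
have [K0 KD KZ] := Kcone.
move=> Ky [e e0 [Kp Km]].
have [->|a0] := eqVneq a 0; first by rewrite scale0r; exact: lineality0.
exists (e / `|a|); first by rewrite divr_gt0 ?normr_gt0.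
rewrite !scalerA.
have [->|->] : e / `|a| * a = e \/ e / `|a| * a = - e.
- rewrite mulrAC; have [/ltW ag|ag] := ltrP 0 a.
    by left; rewrite ger0_norm // mulfK.
  by right; rewrite ler0_norm // invrN mulrN mulfK.
- by [].
- by rewrite scaleNr opprK.
Qed.

Lemma lineality_span y (X : seq 'cV[R]_n) v : K y ->
  {in X, forall u, lineality y u} -> v \in <<X>>%VS -> lineality y v.
Proof.
move=> Ky LX /(@coord_span _ _ _ (in_tuple X)) ->.
elim/big_ind: _ => [|u w|i _]; [exact: lineality0 | exact: linealityD |].
by apply: linealityZ => //; apply: LX; exact: mem_nth.
Qed.

(* z is not in the lineality space of the last point of K met when moving from
   y in the direction -z, so the dimension drops. *)
Lemma lineality_drop (d : nat) y z (t : R) : K y -> lineality y z ->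
  0 <= t -> K z -> K (y - t *: z) ->
  (forall e, 0 < e -> ~ K (y - t *: z - e *: z)) ->
  (forall X, free X -> {in X, forall u, lineality y u} -> (size X <= d.+1)%N) ->
  forall X, free X -> {in X, forall u, lineality (y - t *: z) u} ->
    (size X <= d)%N.
Proof.
have [K0 KD KZ] := Kcone.
move=> Ky Lz t0 Kz Kw maxt dimy X freeX LX.
suff: (size (z :: X) <= d.+1)%N by [].
apply: dimy.
  rewrite free_cons freeX andbT; apply/negP => /(lineality_span Kw LX).
  by case=> e e0 [_]; exact: maxt.
move=> u; rewrite inE => /predU1P[-> //|/LX[e e0 [Kp Km]]].
by exists e => //; split; [have := KD _ _ Kp (KZ _ _ t0 Kz)
  | have := KD _ _ Km (KZ _ _ t0 Kz)]; rewrite addrAC subrK.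
Qed.

Lemma extreme_vectorP y : K y -> y != 0 ->
  (forall z, K z -> K (y - z) -> ray y z) -> extreme_vector K y.
Proof.
have [K0 KD KZ] := Kcone.
move=> Ky y0 min; split=> //; apply/seteqP; split.
  apply: smallest_sub; last by move=> _ ->; exists 1; rewrite /= ?scale1r.
  split; [split; [split|]|].
  - by exists 0; rewrite /= ?scale0r.
  - move=> _ _ [a a0 <-] [b b0 <-]; exists (a + b); rewrite /= ?scalerDl//.
    exact: addr_ge0.
  - by move=> a _ a0 [b b0 <-]; exists (a * b); rewrite /= ?scalerA ?mulr_ge0.
  - by move=> _ [a a0 <-]; exact: KZ.
  - move=> _ z [a /= a0 <-] Kz Kaz; have [a00|an0] := eqVneq a 0.
      move: Kaz; rewrite a00 scale0r sub0r => KNz.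
      by exists 0; rewrite /= ?scale0r // (pointed_eq0 Kz KNz).
    have [b b0 bE] : ray y (a^-1 *: z).
      apply: min; first by apply: KZ; rewrite ?invr_ge0.
      have -> : y - a^-1 *: z = a^-1 *: (a *: y - z).
        by rewrite scalerBr scalerA mulVf // scale1r.
      by apply: KZ; rewrite ?invr_ge0.
    exists (a * b); first exact: mulr_ge0.
    by rewrite -scalerA bE scalerA divff // scale1r.
move=> _ [a a0 <-] F [[[[_ _ FZ] _] _] /(_ y erefl) Fy].
exact: FZ.
Qed.

(** Induction on the dimension of the face generated by [y]: a non-extreme [y] is a nonnegative
    combination of two vectors of [K] that generate faces of smaller dimension. *)
Lemma minkowski_cone (C : set 'cV[R]_n) :
  convex_cone C -> extreme_vector K `<=` C -> K `<=` C.
Proof.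
have [K0 KD KZ] := Kcone.
move=> [C0 CD CZ] exC.
(* [d] bounds the dimension of [lineality y], expressed through the sizes of its free families. *)
suff main d : forall y, K y ->
    (forall X, free X -> {in X, forall u, lineality y u} -> (size X <= d)%N) ->
    C y.
  move=> y Ky; apply: (main (\dim (fullv : {vspace 'cV[R]_n}))) => // X fX _.
  by rewrite -(eqnP fX) dimvS ?subvf.
elim: d => [|d IH] y Ky dimy.
  have [-> //|y0] := eqVneq y 0.
  suff: (size [:: y] <= 0)%N by [].
  apply: dimy; first by rewrite seq1_free.
  move=> u; rewrite inE => /eqP ->; exists 1 => //.
  by rewrite scale1r subrr; split=> //; exact: KD.
have [-> //|y0] := eqVneq y 0.
have [exy|nex] := pselect (extreme_vector K y); first exact: exC.
have [z [Kz Kyz nz]] : exists z, [/\ K z, K (y - z) & ~ ray y z].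
  apply: contrapT => h; apply: nex; apply: extreme_vectorP => // z Kz Kyz.
  by apply: contrapT => nz; apply: h; exists z.
have z0 : z != 0.
  by apply/negP => /eqP z0; apply: nz; exists 0; rewrite /= ?scale0r.
have dom v : K v -> K (y - v) -> lineality y v.
  by move=> Kv Kyv; exists 1 => //; rewrite scale1r; split=> //; exact: KD.
have [t [t0 Kw maxt]] := exists_max_step Ky Kz z0.
set w := y - t *: z in Kw maxt.
have Cw : C w.
  by apply: IH => //; apply: lineality_drop => //; exact: dom.
have w0 : w != 0.
  apply/negP => /eqP /subr0_eq yE; apply: nz.
  have tn0 : t != 0 by apply/eqP => tE; move: y0; rewrite yE tE scale0r eqxx.
  by exists t^-1; rewrite /= ?invr_ge0 // yE scalerA mulVf // scale1r.
(* Moving from [y] in the direction [- w] as far as [K] allows gives the second vector; [y] is its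
   sum with [s *: w]. *)
have [s [s0 Kv maxs]] := exists_max_step Ky Kw w0.
have Cv : C (y - s *: w).
  apply: IH => //; apply: lineality_drop => //; apply: dom => //.
  by rewrite /w subKr; exact: KZ.
by rewrite -(subrK (s *: w) y); apply: CD => //; exact: CZ.
Qed.

End Minkowski.
(** * Facets of the minimal cone *)

Lemma continuous_sum {R : realType} {U : topologicalType} (I : Type) (r : seq I)
    (F : I -> U -> R) :
  (forall i, continuous (F i)) -> continuous (fun y => \sum_(i <- r) F i y).
Proof.
move=> cF; elim: r => [|i r IH].
  by under eq_fun do rewrite big_nil; move=> y; exact: cvg_cst.
by under eq_fun do rewrite big_cons; move=> y; apply: cvgD; [exact: cF | exact: IH].
Qed.

Lemma linear_form_continuous {R : realType} {m p : nat} (phi : 'M[R]_(m, p) -> R) :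
  {morph phi : M N / M + N} -> (forall a M, phi (a *: M) = a * phi M) ->
  continuous phi.
Proof.
move=> phiD phiZ.
have phi0 : phi 0 = 0 by rewrite -(scale0r 0) phiZ mul0r.
have -> : phi = fun M => \sum_i \sum_j M i j * phi (delta_mx i j).
  apply/funext => M; rewrite [in LHS](matrix_sum_delta M).
  rewrite (big_morph phi phiD phi0); apply: eq_bigr => i _.
  by rewrite (big_morph phi phiD phi0); apply: eq_bigr => j _; rewrite phiZ.
apply: continuous_sum => i; apply: continuous_sum => j M.
exact: (cvgMr_tmp (@coord_continuous R m p i j M)).
Qed.

(** The set is arbitrary because the lemma serves both the interior of [K] and the relative interior
    of a face of [pi_cone K]. *)
Lemma nbhs_pull {R : realType} {m p : nat} (S : set 'M[R]_(m, p))
    (z v : 'M[R]_(m, p)) :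
  nbhs z S -> exists2 e : R, 0 < e & S (z - e *: v).
Proof.
move=> Sz.
have cv : (z - (harmonic k : R) *: v) @[k --> \oo] --> z.
  rewrite -[X in _ --> X]subr0; apply: cvgB; first exact: cvg_cst.
  by rewrite -[X in _ --> X](scale0r v); apply: cvgZr_tmp; exact: cvg_harmonic.
have [N _ /(_ N (leqnn N)) SN] := cv _ Sz.
by exists (harmonic N) => //=; rewrite /harmonic /= invr_gt0 ltr0n.
Qed.

(** * The conic hull of the extreme vectors *)

Definition conic_hull {R : realType} {n m : nat} (x : 'I_m -> 'cV[R]_n) :
    set 'cV[R]_n :=
  [set y | exists2 c : 'I_m -> R,
     (forall i, 0 <= c i) & y = \sum_i c i *: x i].

Lemma conic_hull_cone {R : realType} {n m : nat} (x : 'I_m -> 'cV[R]_n) :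
  convex_cone (conic_hull x).
Proof.
split.
- exists (fun=> 0) => //.
  by rewrite big1 // => i _; rewrite scale0r.
- move=> _ _ [c c0 ->] [d d0 ->]; exists (fun i => c i + d i).
    by move=> i; exact: addr_ge0.
  by rewrite -big_split; apply: eq_bigr => i _; rewrite scalerDl.
- move=> a _ a0 [c c0 ->]; exists (fun i => a * c i).
    by move=> i; exact: mulr_ge0.
  by rewrite scaler_sumr; apply: eq_bigr => i _; rewrite scalerA.
Qed.

(** By Minkowski's theorem only extreme vectors must be placed in the hull, and each is a
    nonnegative multiple of some [x i]. *)
Lemma proper_cone_conic_hull {R : realType} {n m : nat} (K : set 'cV[R]_n)
    (x : 'I_m -> 'cV[R]_n) :
  proper_cone K -> lists_extreme_vectors K x -> K = conic_hull x.
Proof.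
move=> [Kcone Kclosed Kpt _] [ex_x x_ex].
have [K0 KD KZ] := Kcone; have [C0 CD CZ] := conic_hull_cone x.
apply/seteqP; split.
  apply: (minkowski_cone Kcone Kclosed Kpt (conic_hull_cone x)).
  move=> y /x_ex [i [yi _]].
  have [a a0 <-] : ray (x i) y.
    by rewrite -yi; exists 1; rewrite /= ?scale1r.
  apply: CZ => //; exists (fun j => (j == i)%:R) => [j|].
    by case: eqP.
  rewrite (bigD1 i) //= eqxx scale1r big1 ?addr0 // => j /negPf ->.
  by rewrite scale0r.
move=> _ [c c0 ->]; elim/big_ind: _ => // i _.
by apply: KZ => //; case: (ex_x i).
Qed.

Lemma alternating_relationE {R : realType} {n : nat}
    (x : 'I_n.+1 -> 'cV[R]_n) :
  alternating_relation x -> \sum_(i < n.+1) (-1) ^+ i *: x i = 0.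
Proof.
rewrite /alternating_relation => rel.
rewrite (bigID [pred i : 'I_n.+1 | odd i]) /=.
rewrite (eq_bigr (fun i => - x i)); last first.
  by move=> i oi; rewrite -signr_odd oi expr1 scaleN1r.
rewrite [X in _ + X](eq_bigr x); last first.
  by move=> i /negPf oi; rewrite -signr_odd oi expr0 scale1r.
rewrite sumrN; apply/eqP; rewrite addrC subr_eq0; apply/eqP.
have evenE : \sum_(i in even_numbered n) x i = \sum_(i < n.+1 | odd i) x i.
  by apply: eq_bigl => i; rewrite finset.inE.
rewrite -evenE -rel; apply: eq_bigl => i; by rewrite finset.inE.
Qed.

Section AlternatingCone.
Context {R : realType} {n : nat} (K : set 'cV[R]_n) (x : 'I_n.+1 -> 'cV[R]_n).
Hypotheses (n_ge3 : (3 <= n)%N) (n_odd : odd n).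
Hypotheses (Kint : K° !=set0) (K_hull : K = conic_hull x).
Hypothesis x_rel : \sum_(i < n.+1) (-1) ^+ i *: x i = 0.

Local Notation "i '<~>' j" :=
  (odd (@nat_of_ord n.+1 i) != odd (@nat_of_ord n.+1 j)) (at level 70).

Lemma K_cone : convex_cone K.
Proof. by rewrite K_hull; exact: conic_hull_cone. Qed.

Let K0 : K 0. Proof. by case: K_cone. Qed.
Let KD y z : K y -> K z -> K (y + z). Proof. by case: K_cone => _ + _; apply. Qed.
Let KZ (a : R) y : 0 <= a -> K y -> K (a *: y).
Proof. by case: K_cone => _ _; apply. Qed.

Lemma K_gen i : K (x i).
Proof.
rewrite K_hull; exists (fun j => (j == i)%:R) => [j|]; first by case: eqP.
rewrite (bigD1 i) //= eqxx scale1r big1 ?addr0 // => j /negPf ->.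
by rewrite scale0r.
Qed.

Lemma K_sum (P : pred 'I_n.+1) (c : 'I_n.+1 -> R) (y : 'I_n.+1 -> 'cV[R]_n) :
  (forall i, P i -> 0 <= c i) -> (forall i, P i -> K (y i)) ->
  K (\sum_(i | P i) c i *: y i).
Proof.
move=> c0 Ky; elim/big_ind: _ => // i Pi.
by apply: KZ; [exact: c0 | exact: Ky].
Qed.

Lemma interior_absorb z (v : 'cV[R]_n) :
  K° z -> exists2 e : R, 0 < e & K (z - e *: v).
Proof. exact: nbhs_pull. Qed.

Let Y : 'M[R]_(n.+1, n) := \matrix_i (x i)^T.

Lemma comb_trmx (c : 'rV[R]_n.+1) : (c *m Y)^T = \sum_i c 0 i *: x i.
Proof.
apply/matrixP => i j; rewrite !mxE summxE; apply: eq_bigr => k _.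
by rewrite !mxE (ord1 j).
Qed.

(** An interior point of [K] makes every vector a multiple of a difference of two members of [K]. *)
Lemma Y_full : row_full Y.
Proof.
have [z Kz] := Kint.
have KY v : K v -> (v^T <= Y)%MS.
  rewrite K_hull => -[c _ ->]; apply/submxP; exists (\row_i c i).
  rewrite -[RHS]trmxK comb_trmx; congr (_^T).
  by apply: eq_bigr => i _; rewrite mxE.
rewrite -sub1mx; apply/row_subP => i.
have [e e0 Ke] := interior_absorb (row i 1%:M)^T Kz.
have -> : row i (1%:M : 'M[R]_n) = (e^-1 *: (z - (z - e *: (row i 1%:M)^T)))^T.
  by rewrite subKr scalerA mulVf ?gt_eqF // scale1r trmxK.
rewrite linearZ linearB /=; apply: scalemx_sub; apply: addmx_sub.
  by apply: KY; exact: interior_subset.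
by rewrite eqmx_opp; exact: KY.
Qed.

(** [Y] has n + 1 rows and rank n, so its left kernel is a line, spanned by the sign vector. *)
Lemma relation_unique (c : 'I_n.+1 -> R) : \sum_i c i *: x i = 0 ->
  exists a : R, forall i, c i = a * (-1) ^+ i.
Proof.
move=> c0.
have kerE (d : 'rV[R]_n.+1) : \sum_i d 0 i *: x i = 0 -> (d <= kermx Y)%MS.
  by move=> d0; apply/sub_kermxP; rewrite -[LHS]trmxK comb_trmx d0 trmx0.
pose s : 'rV[R]_n.+1 := \row_i (-1) ^+ i.
have sK : (s <= kermx Y)%MS.
  by apply: kerE; rewrite -[RHS]x_rel; apply: eq_bigr => i _; rewrite mxE.
have s0 : s != 0.
  apply/negP => /eqP/rowP/(_ ord0)/eqP.
  by rewrite !mxE expr0 oner_eq0.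
have rk : \rank (kermx Y) = 1%N by rewrite mxrank_ker (eqnP Y_full) subSnn.
have : (kermx Y <= s)%MS.
  by rewrite -(geq_leqif (mxrank_leqif_sup sK)) rk rank_rV s0.
move/(submx_trans (kerE (\row_i c i) _)) => /(_ _)/sub_rVP.
case; first by rewrite -[RHS]c0; apply: eq_bigr => i _; rewrite mxE.
move=> a /rowP ca; exists a => i.
by have := ca i; rewrite !mxE.
Qed.

(** A choice of coordinates by a pseudo-inverse; any other choice differs from it by a multiple of
    the sign vector. *)
Definition bary (y : 'cV[R]_n) (i : 'I_n.+1) : R := (y^T *m pinvmx Y) 0 i.

Lemma baryE y : y = \sum_i bary y i *: x i.
Proof. by rewrite -comb_trmx mulmxKpV ?trmxK // submx_full // Y_full. Qed.

(* For i and j of opposite parities these are the facet functionals of K. *)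
Definition facet (i j : 'I_n.+1) (y : 'cV[R]_n) : R := bary y i + bary y j.

Lemma baryD y z i : bary (y + z) i = bary y i + bary z i.
Proof. by rewrite /bary linearD mulmxDl mxE. Qed.

Lemma baryZ a y i : bary (a *: y) i = a * bary y i.
Proof. by rewrite /bary linearZ -scalemxAl mxE. Qed.

Lemma facetD i j y z : facet i j (y + z) = facet i j y + facet i j z.
Proof. by rewrite /facet !baryD addrACA. Qed.

Lemma facetZ i j a y : facet i j (a *: y) = a * facet i j y.
Proof. by rewrite /facet !baryZ mulrDr. Qed.

Lemma facet0 i j : facet i j 0 = 0.
Proof. by rewrite -(scale0r 0) facetZ mul0r. Qed.

Lemma facetB i j y z : facet i j (y - z) = facet i j y - facet i j z.
Proof. by rewrite facetD -scaleN1r facetZ mulN1r. Qed.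

(** The sign vector cancels in a sum over two opposite parities, so the value does not depend on the
    choice made in [bary]. *)
Lemma facet_comb i j (c : 'I_n.+1 -> R) : i <~> j ->
  facet i j (\sum_k c k *: x k) = c i + c j.
Proof.
move=> ij; set y := \sum_k _.
have [a ca] : exists a, forall k, c k - bary y k = a * (-1) ^+ k.
  apply: relation_unique.
  under eq_bigr do rewrite scalerBl.
  by rewrite sumrB -baryE subrr.
have E k : bary y k = c k - a * (-1) ^+ k by rewrite -ca subKr.
rewrite /facet !E -!(signr_odd _ i) -!(signr_odd _ j).
by move: ij; case: (odd i); case: (odd j) => //= _; rewrite expr0 expr1; ring.
Qed.

Lemma facet_gen i j k : i <~> j -> facet i j (x k) = (k == i)%:R + (k == j)%:R.
Proof.
move=> ij; rewrite -(facet_comb (fun l => (k == l)%:R) ij); congr facet.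
rewrite (bigD1 k) //= eqxx scale1r big1 ?addr0 // => l.
by rewrite eq_sym => /negPf ->; rewrite scale0r.
Qed.

Lemma K_facetP y : K y <-> forall i j, i <~> j -> 0 <= facet i j y.
Proof.
split.
  by rewrite K_hull => -[c c0 ->] i j ij; rewrite facet_comb ?addr_ge0.
move=> f0; rewrite (baryE y).
(* Subtracting [bary y i0] times the relation makes the even-indexed coefficients nonnegative by
   minimality and turns the odd-indexed ones into facet values. *)
pose i0 := [arg min_(i < ord0 | ~~ odd i) bary y i]%O.
have [ei0 mini0] : ~~ odd i0 /\ forall i : 'I_n.+1, ~~ odd i -> bary y i0 <= bary y i.
  by rewrite /i0; case: arg_minP => //= i oi mini; split.
have -> : \sum_i bary y i *: x i =
    \sum_i (bary y i - bary y i0 * (-1) ^+ i) *: x i.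
  under [RHS]eq_bigr do rewrite scalerBl -scalerA.
  by rewrite sumrB -scaler_sumr x_rel scaler0 subr0.
apply: K_sum => i _; last exact: K_gen.
rewrite -signr_odd; case: (boolP (odd i)) => oi.
  rewrite expr1 mulrN1 opprK addrC; apply: (f0 i0 i).
  by rewrite oi (negPf ei0).
by rewrite expr0 mulr1 subr_ge0; exact: mini0.
Qed.

Lemma facet_continuous i j : continuous (facet i j).
Proof.
by apply: linear_form_continuous; [exact: facetD | exact: facetZ].
Qed.

(** The facet functionals equal 2 at the sum of all generators, a small multiple of which can be
    subtracted from an interior point; the converse is continuity of finitely many functionals. *)
Lemma interior_facetP y :
  K° y <-> forall i j, i <~> j -> 0 < facet i j y.
Proof.
split.
  move=> /(interior_absorb (\sum_k (1 : R) *: x k)) [e e0 /K_facetP Ke] i j ij.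
  have := Ke i j ij; rewrite facetB facetZ facet_comb // subr_ge0.
  by apply: lt_le_trans; rewrite mulr_gt0.
move=> f0.
have near_f0 : \forall z \near y, forall p : 'I_n.+1 * 'I_n.+1,
    p.1 <~> p.2 -> 0 < facet p.1 p.2 z.
  apply: (@filter_forall _ _ (fun (p : 'I_n.+1 * 'I_n.+1) z =>
    p.1 <~> p.2 -> 0 < facet p.1 p.2 z) (nbhs y) _) => -[i j] /=.
  have [ij|_] := boolP (i <~> j); last first.
    exact: nearW.
  near=> z => _; near: z.
  exact: (@facet_continuous i j y _ (lt_nbhsr (f0 i j ij))).
apply: filterS near_f0 => z fz; apply/K_facetP => i j ij; apply: ltW.
exact: (fz (i, j)).
Unshelve. all: by end_near. Qed.

(** * Primitive matrices and their digraphs *)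

(** Since n is at least 3, the indices 0, 1, 2, 3 provide two of each parity. *)
Lemma other_index (p : bool) (i : 'I_n.+1) :
  exists a : 'I_n.+1, odd a = p /\ a != i.
Proof.
have h (k : nat) : (k < 4)%N -> exists a : 'I_n.+1, a = k :> nat.
  by move=> k4; exists (Ordinal (leq_trans k4 (n_ge3 : 3 < n.+1)%N)).
have [a aE] : exists a : 'I_n.+1, a = p :> nat by apply: h; case: (p).
have [b bE] : exists b : 'I_n.+1, b = p.+2 :> nat by apply: h; case: (p).
have [ai|ai] := eqVneq a i; [exists b | exists a]; split.
- by rewrite bE; case: (p).
- by apply/eqP => bi; move: bE; rewrite bi -ai aE; case: (p).
- by rewrite aE; case: (p).
- by [].
Qed.

Lemma gen_neq0 i : x i != 0.
Proof.
have [j [oj _]] := other_index (~~ odd i) i.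
have ij : i <~> j by rewrite oj; case: (odd i).
apply/eqP => xi; have := facet_gen i ij.
rewrite eqxx xi facet0 => /eqP.
by rewrite eq_sym -natrD pnatr_eq0.
Qed.

Lemma gen_boundary i : exists a b, [/\ a <~> b, a != i, b != i & facet a b (x i) = 0].
Proof.
have [a [oa ai]] := other_index true i; have [b [ob bi]] := other_index false i.
exists a, b; have ab : a <~> b by rewrite oa ob.
by split=> //; rewrite facet_gen // eq_sym (negPf ai) eq_sym (negPf bi) addr0.
Qed.

Lemma pi_coneP (B : 'M[R]_n) : pi_cone K B <-> forall l, K (B *m x l).
Proof.
split=> [piB l|BK]; first by apply: piB; exists (x l) => //; exact: K_gen.
move=> _ [y Ky <-]; move: Ky; rewrite {1}K_hull => -[c c0 ->].
rewrite mulmx_sumr; under eq_bigr do rewrite -scalemxAr.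
exact: K_sum.
Qed.

Lemma pi_cone_mul (B : 'M[R]_n) y : pi_cone K B -> K y -> K (B *m y).
Proof. by move=> piB Ky; apply: piB; exists y. Qed.

Lemma expmxD_mul (B : 'M[R]_n) p q (y : 'cV[R]_n) :
  B ^+ (p + q) *m y = B ^+ p *m (B ^+ q *m y).
Proof. by rewrite exprD mulmxA. Qed.

Lemma expmxS_mul (B : 'M[R]_n) p (y : 'cV[R]_n) :
  B ^+ p.+1 *m y = B *m (B ^+ p *m y).
Proof. by rewrite exprS mulmxA. Qed.

Lemma expmx0_mul (B : 'M[R]_n) (y : 'cV[R]_n) : B ^+ 0 *m y = y.
Proof. by rewrite expr0 mul1mx. Qed.

Lemma pi_cone_exp (B : 'M[R]_n) p : pi_cone K B -> pi_cone K (B ^+ p).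
Proof.
move=> piB; apply/pi_coneP => l; elim: p => [|p IH].
  by rewrite expmx0_mul; exact: K_gen.
by rewrite expmxS_mul; exact: pi_cone_mul.
Qed.

Lemma facet_mul_sum i j (B : 'M[R]_n) (c : 'I_n.+1 -> R) :
  facet i j (B *m (\sum_l c l *: x l)) = \sum_l c l * facet i j (B *m x l).
Proof.
rewrite mulmx_sumr (big_morph (facet i j) (facetD i j) (facet0 i j)).
by apply: eq_bigr => l _; rewrite -facetZ scalemxAr.
Qed.

Lemma maps_to_interiorP (B : 'M[R]_n) :
  maps_to_interior K B <-> forall l, K° (B *m x l).
Proof.
split=> [int l|int].
  apply: int; exists (x l) => //; split; first exact: K_gen.
  by apply/eqP; exact: gen_neq0.
move=> _ [y [Ky y0] <-]; apply/interior_facetP => i j ij.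
move: Ky; rewrite {1}K_hull => -[c c0 yE].
rewrite yE facet_mul_sum.
have intl l : 0 < facet i j (B *m x l) by have /interior_facetP := int l; exact.
have [l cl] : exists l, 0 < c l.
  apply: contrapT => h; apply: y0; rewrite /= yE big1 // => l _.
  have [cl|cl] := eqVneq (c l) 0; first by rewrite cl scale0r.
  by case: h; exists l; rewrite lt_def cl c0.
rewrite (bigD1 l) //=; apply: ltr_pwDl; first exact: mulr_gt0.
by apply: sumr_ge0 => k _; rewrite mulr_ge0 // ltW.
Qed.

(** For [z] and [v] in [K] this says that [v] lies in the face generated by [z]. *)
Definition absorbs (z v : 'cV[R]_n) := exists2 e : R, 0 < e & K (z - e *: v).

Lemma absorbs_refl z : absorbs z z.
Proof. by exists 1 => //; rewrite scale1r subrr. Qed.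

Lemma absorbs_trans z y v : absorbs z y -> absorbs y v -> absorbs z v.
Proof.
move=> [e e0 Ke] [d d0 Kd]; exists (e * d); first exact: mulr_gt0.
have -> : z - (e * d) *: v = (z - e *: y) + e *: (y - d *: v).
  by rewrite scalerBr scalerA addrA subrK.
by apply: KD => //; apply: KZ => //; exact: ltW.
Qed.

Lemma absorbsD z u v : absorbs z u -> absorbs z v -> absorbs z (u + v).
Proof.
move=> [d d0 Kd] [e e0 Ke].
have de0 : 0 < d + e by rewrite addr_gt0.
exists (d * e / (d + e)); first by rewrite divr_gt0 ?mulr_gt0.
have -> : z - (d * e / (d + e)) *: (u + v) =
    (e / (d + e)) *: (z - d *: u) + (d / (d + e)) *: (z - e *: v).
  rewrite !scalerBr scalerDr !scalerA addrACA -scalerDl -mulrDl [e + d]addrC.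
  rewrite divff ?gt_eqF // scale1r opprD.
  by rewrite [e / _ * d]mulrAC [e * d]mulrC [d / _ * e]mulrAC.
by apply: KD; apply: KZ => //; rewrite divr_ge0 ?ltW.
Qed.

Lemma absorbsZ z a v : K z -> 0 <= a -> absorbs z v -> absorbs z (a *: v).
Proof.
move=> Kz a0 [e e0 Ke]; have [->|an0] := eqVneq a 0.
  by exists 1 => //; rewrite scale0r scaler0 subr0.
exists (e / a); first by rewrite divr_gt0 // lt_def an0.
by rewrite scalerA mulfVK.
Qed.

Lemma absorbs_mul (B : 'M[R]_n) z v :
  pi_cone K B -> absorbs z v -> absorbs (B *m z) (B *m v).
Proof.
move=> piB [e e0 Ke]; exists e => //.
by rewrite scalemxAr -mulmxBr; exact: pi_cone_mul.
Qed.

Lemma absorbs_facet i j z v : i <~> j -> absorbs z v ->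
  exists2 e : R, 0 < e & e * facet i j v <= facet i j z.
Proof.
move=> ij [e e0 /K_facetP/(_ i j ij)]; rewrite facetB facetZ subr_ge0.
by exists e.
Qed.

Lemma absorbs_interior z v : absorbs z v -> K° v -> K° z.
Proof.
move=> zv /interior_facetP v0; apply/interior_facetP => i j ij.
have [e e0] := absorbs_facet ij zv.
by apply: lt_le_trans; rewrite mulr_gt0 // v0.
Qed.

Lemma absorbs_gen y : K y -> exists2 c : 'I_n.+1 -> R,
  (forall i, 0 <= c i /\ (c i != 0 -> absorbs y (x i)))
  & y = \sum_i c i *: x i.
Proof.
rewrite {1}K_hull => -[c c0 yE]; exists c => // i; split=> // ci.
exists (c i); first by rewrite lt_def ci c0.
rewrite yE (bigD1 i) //= addrAC subrr add0r.
by apply: K_sum => // j _; exact: K_gen.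
Qed.

(** Inclusion between faces of [K] can be tested on generators, because a face is the conic hull of
    the generators it contains. *)
Lemma absorbs_support z y : K z -> K y ->
  (forall i, absorbs y (x i) -> absorbs z (x i)) -> absorbs z y.
Proof.
move=> Kz /absorbs_gen[c cP yE] yz.
have z0 : absorbs z 0 by exists 1 => //; rewrite scaler0 subr0.
rewrite yE; elim/big_ind: _ => [|u v|i _]; [exact: z0 | exact: absorbsD | ].
have [c0 cn0] := cP i.
have [->|/cn0 yi] := eqVneq (c i) 0; first by rewrite scale0r.
by apply: absorbsZ => //; exact: yz.
Qed.

Lemma boundary_facet y : K y -> ~ K° y ->
  exists i j, i <~> j /\ facet i j y = 0.
Proof.
move=> /K_facetP y0 ny; apply: contrapT => h; apply: ny.
apply/interior_facetP => i j ij; rewrite lt_def y0 // andbT.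
by apply/eqP => f0; apply: h; exists i, j.
Qed.

(** [facet i j] is positive at [x i] and [x j], so a point where it vanishes absorbs neither of
    them. *)
Lemma boundary_absorbs i j k y : i <~> j -> facet i j y = 0 ->
  absorbs y (x k) -> (k != i) && (k != j).
Proof.
move=> ij f0 /(absorbs_facet ij)[e e0]; rewrite f0 facet_gen // -natrD.
rewrite pmulr_rle0 // lern0 addn_eq0.
by case: (k == i); case: (k == j).
Qed.

(** If [B *m z] lay on a facet, so would every [B *m x l], as [z] absorbs all generators; the image
    of [B] would then lie in a hyperplane and no positive power could reach the interior. *)
Lemma primitive_mul_interior B z : primitive K B -> K° z -> K° (B *m z).
Proof.
move=> [piB [p p0 /maps_to_interiorP intp]] Kz; apply: contrapT => nint.
have KBz : K (B *m z) by apply: pi_cone_mul => //; exact: interior_subset.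
have [i [j [ij f0]]] := boundary_facet KBz nint.
have fx l : facet i j (B *m x l) = 0.
  have [e e0] := absorbs_facet ij (absorbs_mul piB (interior_absorb (x l) Kz)).
  rewrite f0 pmulr_rle0 // => fle0; apply/eqP; rewrite eq_le fle0 /=.
  have /K_facetP := pi_cone_mul piB (K_gen l); exact.
case: p p0 intp => [//|p _ /(_ ord0)].
rewrite expmxS_mul => /interior_facetP/(_ i j ij).
rewrite (baryE (B ^+ p *m _)) facet_mul_sum big1 ?ltxx // => l _.
by rewrite fx mulr0.
Qed.

Lemma primitive_exp_interior B p q y : primitive K B -> (p <= q)%N ->
  K° (B ^+ p *m y) -> K° (B ^+ q *m y).
Proof.
move=> prB /subnK <-; elim: (q - p)%N => [//|k IH] /IH.
by rewrite addSn expmxS_mul; exact: primitive_mul_interior.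
Qed.

Lemma primitive_maps_interior B p q : primitive K B -> (p <= q)%N ->
  maps_to_interior K (B ^+ p) -> maps_to_interior K (B ^+ q).
Proof.
move=> prB pq /maps_to_interiorP int; apply/maps_to_interiorP => l.
exact: primitive_exp_interior prB pq (int l).
Qed.

(* [walk B 1] is the arc relation of the digraph of B on the extreme rays; for
   p > 1, [walk B p i j] is only implied by the existence of a walk of length p
   from i to j in that digraph. *)
Definition walk (B : 'M[R]_n) (p : nat) (i j : 'I_n.+1) : Prop :=
  absorbs (B ^+ p *m x i) (x j).

Lemma walk0 B i : walk B 0 i i.
Proof. by rewrite /walk expmx0_mul; exact: absorbs_refl. Qed.

Lemma walk_trans B p q i j k : pi_cone K B ->
  walk B p i j -> walk B q j k -> walk B (p + q) i k.
Proof.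
move=> piB ij jk; rewrite /walk addnC expmxD_mul.
by apply: absorbs_trans jk; apply: absorbs_mul => //; exact: pi_cone_exp.
Qed.

(* The set of generators absorbed by B^(lk) x_u strictly increases with k
   until B^(lk) x_u is interior, and a boundary vector misses two of them. *)
Lemma closed_walk_interior B l u : primitive K B -> (0 < l)%N ->
  walk B l u u -> K° (B ^+ (l * n.-1) *m x u).
Proof.
move=> prB l0 wl; have [piB [p p0 /maps_to_interiorP intp]] := prB.
apply: contrapT => nintN.
pose v k := B ^+ (l * k) *m x u.
have nint k : (k <= n.-1)%N -> ~ K° (v k).
  move=> kn intk; apply: nintN.
  by apply: primitive_exp_interior intk => //; rewrite leq_mul2l kn orbT.
have Kv k : K (v k) by apply: pi_cone_mul (K_gen u); exact: pi_cone_exp.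
have vS k : absorbs (v k.+1) (v k).
  rewrite /v mulnSr expmxD_mul; apply: absorbs_mul => //; exact: pi_cone_exp.
have vlS k q : absorbs (v k) (v k.+1) -> absorbs (v k) (v (k + q)%N).
  move=> vk; elim: q => [|q IH]; first by rewrite addn0; exact: absorbs_refl.
  apply: absorbs_trans vk _; rewrite addnS /v !mulnS !expmxD_mul.
  by apply: absorbs_mul => //; exact: pi_cone_exp.
pose S k := [set i | `[< absorbs (v k) (x i) >]]%SET.
have SP k i : reflect (absorbs (v k) (x i)) (i \in S k).
  by rewrite finset.inE; exact: asboolP.
have cardS k : (k <= n.-1)%N -> (k < #|S k|)%N.
  elim: k => [|k IH] kn.
    apply/card_gt0P; exists u; apply/SP; rewrite /v muln0.
    by rewrite expmx0_mul; exact: absorbs_refl.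
  apply: leq_ltn_trans (IH (ltnW kn)) _; apply: proper_card.
  rewrite fintype.properE; apply/andP; split.
    by apply/fintype.subsetP => i /SP ki; apply/SP; exact: absorbs_trans ki.
  apply/negP => /fintype.subsetP sub; apply: (nint k (ltnW kn)).
  (* If the set stopped growing, [v k] would absorb all later vectors, among them the interior
     vector [v (k + p)]. *)
  have vk : absorbs (v k) (v k.+1).
    by apply: absorbs_support => // i /SP/sub/SP.
  apply: absorbs_interior (vlS k p vk) _.
  apply: primitive_exp_interior (intp u) => //.
  by rewrite mulnDr (leq_trans _ (leq_addl _ _)) // leq_pmull.
have [i [j [ij f0]]] := boundary_facet (Kv n.-1) (nint _ (leqnn _)).
have := cardS _ (leqnn n.-1); rewrite ltnNge => /negP; apply.
have : S n.-1 \subset ~: [set i; j]%SET.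
  apply/fintype.subsetP => k /SP /(boundary_absorbs ij f0).
  by rewrite !finset.inE negb_or.
move/subset_leq_card/leq_trans; apply.
have ninj : i != j by apply: contraNneq ij => ->.
by rewrite cardsCs finset.setCK card_ord cards2 ninj; lia.
Qed.

Lemma arc_gen B i : pi_cone K B -> exists2 c : 'I_n.+1 -> R,
  (forall j, 0 <= c j /\ (c j != 0 -> walk B 1 i j))
  & B *m x i = \sum_j c j *: x j.
Proof.
move=> piB; have [c cP cE] := absorbs_gen (pi_cone_mul piB (K_gen i)).
by exists c => // j; rewrite /walk expr1; exact: cP.
Qed.

Lemma single_arc B i j : pi_cone K B -> (forall k, walk B 1 i k -> k = j) ->
  exists2 c : R, 0 <= c & B *m x i = c *: x j.
Proof.
move=> piB ij; have [c cP ->] := arc_gen i piB.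
exists (c j); first by case: (cP j).
rewrite (bigD1 j) //= big1 ?addr0 // => k kj.
have [_ ck] := cP k; have [->|/ck/ij kE] := eqVneq (c k) 0.
  by rewrite scale0r.
by rewrite kE eqxx in kj.
Qed.

Lemma primitive_gen_neq0 B i : primitive K B -> B *m x i != 0.
Proof.
move=> [piB [[//|p] _ /maps_to_interiorP/(_ i)]].
rewrite -(addn1 p) expmxD_mul expr1 => int; apply/eqP => Bx.
move: int; rewrite Bx mulmx0.
have [a [b [ab _ _ _]]] := gen_boundary i.
by move=> /interior_facetP/(_ a b ab); rewrite facet0 ltxx.
Qed.

Lemma primitive_arc B i : primitive K B -> exists j, walk B 1 i j.
Proof.
move=> prB; have [piB _] := prB; have [c cP cE] := arc_gen i piB.
apply: contrapT => h; have := primitive_gen_neq0 i prB.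
rewrite cE big1 ?eqxx // => j _; have [_ cj] := cP j.
by have [->|/cj ?] := eqVneq (c j) 0; [rewrite scale0r | case: h; exists j].
Qed.

(* Otherwise B would permute the rays of P. *)
Lemma primitive_branching B (P : 'I_n.+1 -> Prop) i : primitive K B ->
  (forall v, P v -> exists2 j, P j & forall k, walk B 1 v k -> k = j) ->
  ~ P i.
Proof.
move=> [piB [p _ /maps_to_interiorP/(_ i) int]] single Pi.
have [j _ [c cE]] : exists2 j, P j & exists c : R, B ^+ p *m x i = c *: x j.
  elim: p {int} => [|p [j Pj [c cE]]].
    by exists i => //; exists 1; rewrite expmx0_mul scale1r.
  have [k Pk kP] := single j Pj; exists k => //.
  have [d _ dE] := single_arc piB kP.
  by exists (c * d); rewrite expmxS_mul cE -scalemxAr dE scalerA.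
have [a [b [ab _ _ fab]]] := gen_boundary j.
by move: int; rewrite cE => /interior_facetP/(_ a b ab); rewrite facetZ fab mulr0 ltxx.
Qed.

Lemma path_walk B (w : nat -> 'I_n.+1) a b : pi_cone K B -> (a <= b)%N ->
  (forall k, (a <= k < b)%N -> walk B 1 (w k) (w k.+1)) ->
  walk B (b - a) (w a) (w b).
Proof.
move=> piB /subnKC <-; rewrite addKn; elim: (b - a)%N => [|k IH] arcs.
  by rewrite addn0; exact: walk0.
have wk : walk B k (w a) (w (a + k)%N) by apply: IH => l lk; apply: arcs; lia.
rewrite addnS -(addn1 k); apply: (walk_trans piB wk); apply: arcs; lia.
Qed.

(** * The digraph forced by a slow generator *)

Section ExtremalDigraph.
Variables (B : 'M[R]_n) (u : 'I_n.+1).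
Hypotheses (prB : primitive K B) (slow : ~ K° (B ^+ (n * n.-1) *m x u)).

Let piB : pi_cone K B. Proof. by case: prB. Qed.

(** [B ^+ (i + l * n.-1) *m x u] is interior, so i + l(n-1) exceeds n(n-1); with i + l <= n + 1 and
    n >= 3 only i = 1, l = n remains. Taking i = 0, [walk B l u u] fails for 0 < l <= n. *)
Lemma slow_walk i l v : walk B i u v -> walk B l v v -> (0 < l <= n)%N ->
  (i + l <= n.+1)%N -> i = 1%N /\ l = n.
Proof.
move=> uv vv /andP[l0 ln] il.
have : ~ (i + l * n.-1 <= n * n.-1)%N.
  move=> le; apply: slow; apply: primitive_exp_interior le _ => //.
  rewrite addnC expmxD_mul; apply: absorbs_interior.
    by apply: absorbs_mul uv; exact: pi_cone_exp.
  exact: closed_walk_interior.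
by move=> h; split; apply: contrapT => ne; apply: h; nia.
Qed.

Let spanning (w : nat -> 'I_n.+1) := {in [pred a | (a <= n)%N] &, injective w}.

Let spanning_onto w : spanning w ->
  forall v, exists2 b : nat, (b <= n)%N & v = w b.
Proof.
move=> inj v; have inj' : injective (fun a : 'I_n.+1 => w a).
  by move=> a b /inj ab; apply/val_inj/ab; rewrite inE -ltnS.
exists (invF inj' v); first by rewrite -ltnS.
by rewrite (f_invF inj').
Qed.

(** Iterating a choice of arcs from [u] visits all vertices before repeating, and by [slow_walk] the
    first repetition is at [w 0] or at [w 1]. In the second case the arc from [w n] to [u] must be
    found among the arcs not chosen. *)
Lemma hamiltonian_walk : exists w : nat -> 'I_n.+1,
  [/\ spanning w, w 0%N = u,
      forall a, (a < n)%N -> walk B 1 (w a) (w a.+1) & walk B 1 (w n) u].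
Proof.
have [f arcf] := choice (fun v => primitive_arc v prB).
pose w a := iter a f u.
have arcw a : walk B 1 (w a) (w a.+1) by exact: arcf.
have ww a b : (a <= b)%N -> walk B (b - a) (w a) (w b).
  by move=> ab; apply: path_walk.
have [i io wio] : exists2 i, (i < fingraph.order f u)%N & w (fingraph.order f u) = w i.
  by have /trajectP := looping_order f u.
have on : (fingraph.order f u <= n.+1)%N by rewrite -[X in (_ <= X)%N]card_ord max_card.
have uv : walk B i u (w i) by rewrite -[i in walk _ i]subn0; exact: ww.
have vv : walk B (fingraph.order f u - i) (w i) (w i).
  by rewrite -[X in walk _ _ _ X]wio; apply/ww/ltnW.
have winj : fingraph.order f u = n.+1 -> spanning w.
  move=> oE a b; rewrite !inE => an bn ab.
  have [ao bo] : (a < fingraph.order f u)%N /\ (b < fingraph.order f u)%N.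
    by split; rewrite oE ltnS.
  have nthE c : (c < fingraph.order f u)%N -> nth u (fingraph.orbit f u) c = w c.
    by move=> co; rewrite nth_traject.
  apply/eqP; rewrite -(nth_uniq u _ _ (orbit_uniq f u)) ?size_orbit //.
  by rewrite (nthE a ao) (nthE b bo) ab.
have [oi|oi] := leqP (fingraph.order f u - i) n; last first.
  have oE : fingraph.order f u = n.+1 by lia.
  have iE : i = 0%N by lia.
  exists w; split=> //; first exact: winj.
  by have := arcw n; rewrite -oE wio iE.
have [] := slow_walk uv vv; [by lia|by lia|].
move=> iE oiE; have oE : fingraph.order f u = n.+1 by lia.
have {winj}inj := winj oE; move: wio; rewrite iE oE => wn.
exists w; split=> //; apply: contrapT => nwu.
(* Without that arc, each of [w 1], ..., [w n] would have a single out-arc, ending in the same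
   set. *)
apply: (@primitive_branching B
  (fun v => exists2 a, (0 < a <= n)%N & v = w a) (w 1%N)) => //; last first.
  by exists 1%N => //; lia.
move=> _ [a /andP[a0 an] ->]; exists (w a.+1).
  have [aE|aE] := eqVneq a n; first by exists 1%N; [lia | rewrite aE].
  by exists a.+1; [lia | ].
move=> v; have [b bn ->] := spanning_onto inj v => ab.
have ub : walk B b u (w b) by rewrite -[b in walk _ b]subn0; exact: ww.
have [b0|b0] := posnP b.
  have ua : walk B (a - 0) u (w a) by exact: ww.
  have aE : a = n.
    have uu : walk B (a - 0 + 1) u u.
      by apply: walk_trans piB ua _; rewrite b0 in ab; exact: ab.
    by apply: contrapT => aE; have [] := slow_walk (walk0 B u) uu; lia.
  by case: nwu; rewrite -aE; rewrite b0 in ab.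
have [ba|ab'] := leqP b a.
  have [] := slow_walk ub (walk_trans piB (ww _ _ ba) ab); [by lia|by lia|].
  by move=> bE abE; have aE : a = n by [lia]; rewrite aE wn bE.
have [->//|ba] := eqVneq b a.+1.
(* A forward jump shortens the circuit through [w 1] to a length below n. *)
have w1 : walk B 1 u (w 1%N) by exact: (arcw 0%N).
have arcn : walk B 1 (w n) (w 1%N) by rewrite -wn; exact: arcw.
have := walk_trans piB (walk_trans piB (walk_trans piB (ww _ _ a0) ab)
  (ww _ _ bn)) arcn.
move/(slow_walk w1) => h; exfalso; have [] := h _ _; lia.
Qed.

(** Any arc other than those of the Hamiltonian circuit and the chord would create a closed walk
    excluded by [slow_walk]; without the chord [B] would permute the extreme rays. *)
Lemma extremal_digraph : exists2 tau : {perm 'I_n.+1}, tau ord0 = u &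
  forall a b, walk B 1 (tau a) (tau b) <->
    (b = a.+1 :> nat) \/ (a = n :> nat /\ (b <= 1)%N).
Proof.
have [w [inj wu arcw arcn]] := hamiltonian_walk.
have inj' : injective (fun a : 'I_n.+1 => w a).
  by move=> a b /inj ab; apply/val_inj/ab; rewrite inE -ltnS.
have ww a b : (a <= b <= n)%N -> walk B (b - a) (w a) (w b).
  by move=> ab; apply: path_walk => //; [lia | move=> k kb; apply: arcw; lia].
have only a b : (a <= n)%N -> (b <= n)%N -> walk B 1 (w a) (w b) ->
    b = a.+1 \/ (a = n /\ (b <= 1)%N).
  move=> an bn ab; apply: contrapT => nab.
  have ub : walk B b u (w b) by rewrite -[b in walk _ b]subn0 -wu; exact: ww.
  have [ba|ab'] := leqP b a.
    have bb : walk B (a - b + 1) (w b) (w b) by apply: walk_trans ab => //; apply: ww; lia.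
    by have [] := slow_walk ub bb; lia.
  (* A forward jump, continued through [w n], returns to [u] in at most n steps. *)
  have ua : walk B a u (w a) by rewrite -[a in walk _ a]subn0 -wu; apply: ww; lia.
  have bw : walk B (n - b) (w b) (w n) by apply: ww; lia.
  have := walk_trans piB (walk_trans piB (walk_trans piB ua ab) bw) arcn.
  by move/(slow_walk (walk0 B u)) => h; have [] := h _ _; lia.
have arc1 : walk B 1 (w n) (w 1%N).
  apply: contrapT => n1.
  apply: (@primitive_branching B (fun=> True) u) => // v _.
  have [a an ->] := spanning_onto inj v.
  exists (w (if (a == n) then 0%N else a.+1)) => // k.
  have [b bn ->] := spanning_onto inj k => ab.
  have [bE|[aE b1]] := only a b an bn ab.
    by rewrite bE; case: eqP => // aE; exfalso; lia.
  rewrite aE eqxx; case: b b1 bn ab => [//|[|//]] _ _; rewrite aE.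
  by move/n1.
exists (perm inj') => [|a b]; first by rewrite permE.
rewrite !permE; split.
  by apply: only; rewrite -ltnS.
case=> [bE|[-> b1]]; first by rewrite bE; apply: arcw; rewrite -bE -ltnS.
by case: (b : nat) b1 => [|[|//]] _ //; rewrite wu.
Qed.

End ExtremalDigraph.

(** If the power n(n-1) does not yet make [x u] interior, the extremal digraph puts [w 1] one arc
    away from [u] on a circuit of length n, and one more power suffices. *)
Lemma primitive_exponent_le B :
  primitive K B -> maps_to_interior K (B ^+ (n * n.-1).+1).
Proof.
move=> prB; apply/maps_to_interiorP => u; apply: contrapT => nint.
have slow : ~ K° (B ^+ (n * n.-1) *m x u).
  by move=> /(primitive_exp_interior prB (leqnSn _)).
have [piB _] := prB.
have [tau tu arcs] := extremal_digraph prB slow.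
pose w a := tau (inord a).
have walk1 : walk B (n - 1) (w 1%N) (w n).
  apply: path_walk => // [|k /andP[k1 kn]]; first by lia.
  by apply/arcs; left; rewrite !inordK //; lia.
have walkn : walk B 1 (w n) (w 1%N).
  by apply/arcs; right; rewrite !inordK //; lia.
have wn := walk_trans piB walk1 walkn.
rewrite subnK in wn; last by lia.
have u1 : walk B 1 u (w 1%N).
  by rewrite -tu; apply/arcs; left; rewrite inordK //; lia.
apply: nint; rewrite -(addn1 (n * n.-1)) expmxD_mul; apply: absorbs_interior.
  by apply: absorbs_mul u1; exact: pi_cone_exp.
by apply: closed_walk_interior => //; lia.
Qed.

(** * The matrices A_alpha *)

Local Notation "'x_[' k ]" := (x (inord k)) (at level 0).

Let inord0 : inord 0 = ord0 :> 'I_n.+1.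
Proof. by apply: val_inj; rewrite /= inordK. Qed.

Let inord_max : inord n = ord_max :> 'I_n.+1.
Proof. by apply: val_inj; rewrite /= inordK. Qed.

Lemma mulmx_gen_ext (M N : 'M[R]_n) : (forall i, M *m x i = N *m x i) -> M = N.
Proof.
move=> MN; apply/matrixP => i j.
have MNy (y : 'cV[R]_n) : M *m y = N *m y.
  rewrite (baryE y) !mulmx_sumr; apply: eq_bigr => k _.
  by rewrite -!scalemxAr MN.
have := MNy (delta_mx j ord0) => /matrixP/(_ i ord0).
by rewrite -!colE !mxE.
Qed.

Section AAlpha.
Variables (alpha : R) (A : 'M[R]_n).
Hypotheses (alpha_gt0 : 0 < alpha) (A_alpha : is_A_alpha x alpha A).

Lemma A_alpha0 : A *m x_[0] = (1 + alpha) *: x_[1].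
Proof. by have [<- _ _] := A_alpha; rewrite inord0. Qed.

Lemma A_alphaS k : (0 < k < n)%N -> A *m x_[k] = x_[k.+1].
Proof.
move=> /andP[k0 kn]; have [_ /(_ (inord k)) E _] := A_alpha.
by rewrite E inordK ?k0 // ltnW.
Qed.

Lemma A_alpha_max : A *m x_[n] = x_[0] + alpha *: x_[1].
Proof. by have [_ _ E] := A_alpha; rewrite inord0 -E inord_max. Qed.

Lemma A_alpha_exp a k : (0 < a)%N -> (a + k <= n)%N ->
  A ^+ k *m x_[a] = x_[(a + k)%N].
Proof.
move=> a0; elim: k => [|k IH] akn; first by rewrite addn0 expmx0_mul.
rewrite expmxS_mul IH; last by lia.
by rewrite A_alphaS ?addnS //; lia.
Qed.

(** The defect [Q] commutes with [A] and kills [x_[1]], whose orbit under [A] spans the space. *)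
Lemma A_alpha_annihil : A ^+ n.+1 = alpha *: A + (1 + alpha)%:M.
Proof.
pose Q := A ^+ n.+1 - (alpha *: A + (1 + alpha)%:M).
suff Q0 : Q = 0 by apply/eqP; rewrite -subr_eq0 -/Q Q0.
have AQ y : A *m (Q *m y) = Q *m (A *m y).
  rewrite !mulmxA; congr (_ *m y); rewrite mulmxBr mulmxBl mulmxDr mulmxDl.
  by rewrite -scalemxAr -scalemxAl scalar_mxC; congr (_ - _);
    rewrite -[LHS]exprS -[RHS]exprSr.
have A1 k : (0 < k <= n)%N -> x_[k] = A ^+ k.-1 *m x_[1].
  by move=> kn; rewrite A_alpha_exp //; [congr (x (inord _)) | ]; lia.
have Q1 : Q *m x_[1] = 0.
  rewrite mulmxBl mulmxDl -scalemxAl mul_scalar_mx.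
  have -> : n.+1 = (1 + (1 + n.-1))%N by lia.
  rewrite expmxD_mul expmxD_mul A_alpha_exp //; last by lia.
  have -> : (1 + n.-1)%N = n by lia.
  rewrite expr1 A_alpha_max mulmxDr A_alpha0 -scalemxAr.
  by apply/eqP; rewrite subr_eq0 addrC.
have Qk k : (0 < k <= n)%N -> Q *m x_[k] = 0.
  move=> kn; rewrite A1 //; elim: k.-1 => [|j IH]; first by rewrite expmx0_mul.
  by rewrite expmxS_mul -AQ IH mulmx0.
have Q0 : Q *m x_[0] = 0.
  have -> : x_[0] = A *m x_[n] - alpha *: x_[1] by rewrite A_alpha_max addrK.
  rewrite mulmxBr -scalemxAr -AQ !Qk; [|lia|lia].
  by rewrite mulmx0 scaler0 subr0.
apply: mulmx_gen_ext => i; rewrite mul0mx -[i]inord_val.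
by have [->|i0] := posnP i; [exact: Q0 | apply: Qk; rewrite i0 -ltnS ltn_ord].
Qed.

Lemma A_alpha_pi : pi_cone K A.
Proof.
apply/pi_coneP => i; rewrite -[i]inord_val.
have := ltn_ord i; rewrite ltnS leq_eqVlt => /predU1P[->|lin].
  rewrite A_alpha_max; apply: KD; first exact: K_gen.
  by apply: KZ; [exact: ltW | exact: K_gen].
have [->|i0] := posnP i.
  by rewrite A_alpha0; apply: KZ (K_gen _); rewrite addr_ge0 // ltW.
by rewrite A_alphaS ?i0 //; exact: K_gen.
Qed.

(** By [A_alpha_annihil], [A ^+ n.+1] has the arcs of [A] and a loop at each vertex, so its walks
    can be padded to a common length. *)
Lemma A_alpha_primitive : primitive K A.
Proof.
have piA := A_alpha_pi.
pose B := A ^+ n.+1.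
have piB : pi_cone K B by exact: pi_cone_exp.
have BE y : B *m y = alpha *: (A *m y) + (1 + alpha) *: y.
  by rewrite /B A_alpha_annihil mulmxDl -scalemxAl mul_scalar_mx.
have a1 : 0 < 1 + alpha by rewrite addr_gt0.
have stay i : walk B 1 i i.
  rewrite /walk expr1 BE; exists (1 + alpha) => //.
  by rewrite addrK; apply: KZ; [exact: ltW | exact: pi_cone_mul (K_gen i)].
have via_A i y : absorbs (A *m x i) y -> absorbs (B *m x i) y.
  apply: absorbs_trans; exists alpha => //.
  by rewrite BE addrAC subrr add0r; apply: KZ; [exact: ltW | exact: K_gen].
have step k : (k < n)%N -> walk B 1 (inord k) (inord k.+1).
  move=> kn; rewrite /walk expr1; apply: via_A.
  have [->|k0] := posnP k; last first.
    by rewrite A_alphaS ?k0 //; exact: absorbs_refl.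
  by rewrite A_alpha0; exists (1 + alpha) => //; rewrite subrr.
have wrap : walk B 1 (inord n) (inord 0).
  rewrite /walk expr1; apply: via_A; rewrite A_alpha_max; exists 1 => //.
  by rewrite scale1r addrAC subrr add0r; apply: KZ; [exact: ltW | exact: K_gen].
have pad m i : walk B m i i.
  elim: m => [|m IH]; first exact: walk0.
  by rewrite -addn1; exact: walk_trans piB IH (stay i).
have wB (i j : 'I_n.+1) : walk B (2 * n).+1 i j.
  have up a b : (a <= b <= n)%N -> walk B (b - a) (inord a) (inord b).
    move=> /andP[ab bn]; apply: (path_walk piB (w := fun k => inord k)) => //.
    by move=> k /andP[_ kb]; apply: step; exact: leq_trans kb bn.
  have := ltn_ord i; have := ltn_ord j; rewrite !ltnS => jn lin.
  have i2n : (i <= n <= n)%N by rewrite lin leqnn.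
  (* The pieces have lengths n - i, 1, j and n + i - j, in total 2n + 1. *)
  have := walk_trans piB (walk_trans piB (walk_trans piB (up i n i2n) wrap)
    (up 0 j jn)) (pad (n + i - j)%N (inord j)).
  rewrite !inord_val; congr walk; lia.
split=> //; exists (n.+1 * (2 * n).+1)%N => //.
apply/maps_to_interiorP => i; apply/interior_facetP => a b ab.
rewrite exprM; have [e e0] := absorbs_facet ab (wB i a).
apply: lt_le_trans; rewrite facet_gen // eqxx mulr_gt0 //.
by rewrite ltr_wpDr.
Qed.

(* A^(n(n-1)) = (A^(n+1))^(n-2) A^2 sends x_0 into the cone spanned by the
   x_i with i >= 2, since A^(n+1) = alpha A + (1 + alpha). *)
Lemma A_alpha_slow : ~ maps_to_interior K (A ^+ (n * n.-1)).
Proof.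
have o01 : (inord 0 : 'I_n.+1) <~> (inord 1 : 'I_n.+1) by rewrite !inordK //; lia.
move=> /maps_to_interiorP/(_ (inord 0))/interior_facetP/(_ _ _ o01).
have -> : (n * n.-1 = n.+1 * (n - 2) + (1 + 1))%N by nia.
rewrite expmxD_mul expmxD_mul !expr1 A_alpha0 -scalemxAr A_alphaS; last by lia.
rewrite -scalemxAr facetZ exprM A_alpha_annihil.
set B := (alpha *: A + _).
suff main m r : (2 <= r)%N -> (r + m <= n)%N ->
    facet (inord 0) (inord 1) (B ^+ m *m x_[r]) = 0.
  by rewrite main ?mulr0 ?ltxx //; lia.
elim: m r => [|m IH] r r2 rm.
  rewrite expmx0_mul facet_gen // -!(inj_eq val_inj) /= !inordK; [|lia..].
  by rewrite !gtn_eqF ?addr0 //; lia.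
rewrite -(addn1 m) expmxD_mul expr1 mulmxDl -scalemxAl mul_scalar_mx.
rewrite A_alphaS; last by lia.
rewrite mulmxDr -!scalemxAr facetD !facetZ !IH; [|lia..].
by rewrite !mulr0 addr0.
Qed.

Lemma A_alpha_exponent : mx_exponent K A (n * n.-1).+1.
Proof.
split=> //; first exact: A_alpha_primitive.
  exact/primitive_exponent_le/A_alpha_primitive.
move=> p p0 intp; rewrite ltnNge; apply/negP => ple; apply: A_alpha_slow.
exact: primitive_maps_interior A_alpha_primitive ple intp.
Qed.

Lemma cone_exponentE : cone_exponent K (n * n.-1).+1.
Proof.
split; first by exists A; exact: A_alpha_exponent.
move=> B h [prB _ _ hmin]; apply: hmin => //.
exact: primitive_exponent_le.
Qed.

Lemma A_alpha_exp_maximal : exp_maximal_mx K A.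
Proof. by exists (n * n.-1).+1; [exact: A_alpha_exponent | exact: cone_exponentE]. Qed.

(** [A] attains the upper bound n(n-1) + 1, so an exp-maximal [B] must attain it too. *)
Lemma exp_maximal_slow B : exp_maximal_mx K B ->
  primitive K B /\ exists u, ~ K° (B ^+ (n * n.-1) *m x u).
Proof.
move=> [g [prB _ _ gmin] [_ gmax]]; split=> //.
apply: contrapT => h; have := gmax _ _ A_alpha_exponent.
rewrite leqNgt ltnS => /negP; apply; apply: gmin; first by nia.
apply/maps_to_interiorP => u; apply: contrapT => hu; apply: h; by exists u.
Qed.

End AAlpha.

(** * Classification of exp-maximal matrices *)

(** The generators satisfy a single relation, so a linear map can be prescribed on them once the
    images satisfy it as well. *)
Lemma linear_extension (z : 'I_n.+1 -> 'cV[R]_n) :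
  \sum_(i < n.+1) (-1) ^+ i *: z i = 0 ->
  exists P : 'M[R]_n, forall i, P *m x i = z i.
Proof.
move=> z_rel; pose Z : 'M[R]_(n.+1, n) := \matrix_i (z i)^T.
have PE (y : 'cV[R]_n) : (pinvmx Y *m Z)^T *m y = \sum_i bary y i *: z i.
  rewrite -[y in LHS]trmxK -trmx_mul mulmxA.
  apply/matrixP => k l; rewrite mxE mxE summxE; apply: eq_bigr => i _.
  by rewrite [RHS]mxE (ord1 l) /bary; congr (_ * _); rewrite !mxE.
exists (pinvmx Y *m Z)^T => j; rewrite PE.
have [a ca] : exists a, forall k, (k == j)%:R - bary (x j) k = a * (-1) ^+ k.
  apply: relation_unique; under eq_bigr do rewrite scalerBl.
  rewrite sumrB -baryE (bigD1 j) //= eqxx scale1r big1 ?addr0 ?subrr // => k.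
  by move/negPf=> ->; rewrite scale0r.
under eq_bigr => k _ do
  rewrite -[bary _ k](subKr (k == j)%:R) ca scalerBl -scalerA.
rewrite sumrB -scaler_sumr z_rel scaler0 subr0.
rewrite (bigD1 j) //= eqxx scale1r big1 ?addr0 // => k /negPf ->.
by rewrite scale0r.
Qed.

Lemma inverse_automorphism (P Q : 'M[R]_n) : pi_cone K P -> pi_cone K Q ->
  Q *m P = 1%:M -> automorphism K P.
Proof.
move=> piP piQ QP; have PQ := mulmx1C QP.
split; first by case: (mulmx1_unit QP).
apply/seteqP; split; first exact: piP.
move=> y Ky; exists (Q *m y); first exact: pi_cone_mul.
by rewrite mulmxA PQ mul1mx.
Qed.

(** * Matrices acting along a circuit with one chord *)

Section CyclicImages.
Variables (B : 'M[R]_n) (tau : {perm 'I_n.+1}).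
Variables (c : nat -> R) (p q : R).

Let t k := tau (inord k).

Hypothesis B_step : forall k, (k < n)%N -> B *m x (t k) = c k *: x (t k.+1).
Hypothesis B_last : B *m x (t n) = p *: x (t 0%N) + q *: x (t 1%N).

Let b k := odd (t k).

(* Apply B to the alternating relation and compare coefficients. *)
Lemma cyclic_relation : exists l : R,
  [/\ p * (-1) ^+ b n = l * (-1) ^+ b 0%N,
      c 0%N * (-1) ^+ b 0%N + q * (-1) ^+ b n = l * (-1) ^+ b 1%N
    & forall k, (0 < k < n)%N -> c k * (-1) ^+ b k = l * (-1) ^+ b k.+1].
Proof.
(* [d k] is the coefficient of [x (t k)] once [B] is applied to the relation; [t 1%N] receives
   contributions from both [t 0%N] and [t n]. *)
pose d k : R := if k is j.+1 then
    c j * (-1) ^+ b j + (if j is 0%N then q * (-1) ^+ b n else 0)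
  else p * (-1) ^+ b n.
have reindex_tau (F : 'I_n.+1 -> 'cV[R]_n) : \sum_i F i = \sum_(k < n.+1) F (t k).
  by rewrite (reindex_inj (@perm_inj _ tau)); apply: eq_bigr => k _; rewrite /t inord_val.
have dE : \sum_(k < n.+1) d k *: x (t k) = 0.
  have : B *m (\sum_(i < n.+1) (-1) ^+ i *: x i) = 0 by rewrite x_rel mulmx0.
  rewrite mulmx_sumr reindex_tau => rel0.
  have stepE : \sum_(k < n) B *m ((-1) ^+ t k *: x (t k)) =
      \sum_(k < n) (c k * (-1) ^+ b k) *: x (t k.+1).
    apply: eq_bigr => k _; rewrite -signr_odd -scalemxAr B_step //.
    by rewrite scalerA mulrC.
  have firstE : \sum_(k < n) (if k == 0%N :> nat then q * (-1) ^+ b n else 0) *: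
      x (t k.+1) = (q * (-1) ^+ b n) *: x (t 1%N).
    have n0 : (0 < n)%N by lia.
    rewrite (bigD1 (Ordinal n0)) //= big1 ?addr0 // => k k0.
    by have /negPf -> : k != 0%N :> nat by []; rewrite scale0r.
  rewrite -[RHS]rel0 [RHS]big_ord_recr [LHS]big_ord_recl /= stepE.
  have -> : (-1) ^+ t n = (-1) ^+ b n :> R by rewrite -signr_odd.
  rewrite -scalemxAr B_last.
  rewrite scalerDr !scalerA [_ * p]mulrC [_ * q]mulrC -firstE [RHS]addrCA.
  congr (_ + _); rewrite -big_split  /=; apply: eq_bigr => k _.
  rewrite -scalerDl; congr (_ *: _).
  by rewrite !add0n; case: (k : nat).
have [l lE] : exists l : R, forall i, d ((tau^-1)%g i) = l * (-1) ^+ i.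
  apply: relation_unique; rewrite reindex_tau -[RHS]dE; apply: eq_bigr => k _.
  by rewrite /t permK inord_val.
have dl k : (k <= n)%N -> d k = l * (-1) ^+ b k.
  by move=> kn; have := lE (t k); rewrite /t permK inordK // signr_odd.
exists l; split.
- by have := dl 0%N isT.
- by rewrite -dl //; lia.
- by case=> // k /andP[_ kn]; have := dl k.+2 kn; rewrite /= addr0.
Qed.

(** As n is odd, the signs also alternate from [t n] to [t 0%N], and [mu] is minus the factor of
    [cyclic_relation]. The coefficients may vanish, as they do for some elements of the face of
    [A_alpha]. *)
Lemma alternating_images : (forall k, (k <= n)%N -> b k = odd k (+) b 0%N) ->
  exists mu : R, [/\ p = mu, c 0%N = mu + q
    & forall k, (0 < k < n)%N -> c k = mu].
Proof.
move=> bE; have [l [pE c0E cE]] := cyclic_relation; exists (- l).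
have bn : b n = ~~ b 0%N by rewrite bE // n_odd.
have b1 : b 1%N = ~~ b 0%N by rewrite bE //; lia.
have sN (e : bool) : (-1) ^+ (~~ e) = - (-1) ^+ e :> R.
  by case: e; rewrite ?expr0 ?expr1 ?opprK.
have s0 (e : bool) : (-1) ^+ e != 0 :> R by rewrite signr_eq0.
split.
- by apply: (mulIf (s0 (b n))); rewrite pE bn sN mulNr mulrN opprK.
- apply: (mulIf (s0 (b 0%N))); rewrite mulrDl mulNr; move: c0E.
  by rewrite b1 bn sN !mulrN => <-; rewrite subrK.
- move=> k kn; apply: (mulIf (s0 (b k))); rewrite cE //.
  have -> : b k.+1 = ~~ b k.
    rewrite (bE k.+1); last by lia.
    by rewrite (bE k); [rewrite /=; case: odd; case: b | lia].
  by rewrite sN mulNr mulrN.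
Qed.

(** The sign of the factor [l] decides: were it not negative, all indices would have the same
    parity. *)
Lemma positive_images_alternate : 0 < p -> (forall k, (0 < k < n)%N -> 0 < c k) ->
  forall k, (k <= n)%N -> b k = odd k (+) b 0%N.
Proof.
move=> p0 c0; have [l [pE _ cE]] := cyclic_relation.
have sgnE (a : R) (e f : bool) : 0 < a -> a * (-1) ^+ e = l * (-1) ^+ f ->
    e = f (+) (l < 0).
  move=> a0; case: e; case: f; rewrite ?expr0 ?expr1 ?mulr1 ?mulrN1.
  - by move/oppr_inj => <-; rewrite ltNge ltW.
  - by move=> <-; rewrite oppr_lt0 a0.
  - by move=> aE; rewrite -[l]opprK -aE oppr_lt0 a0.
  - by move=> <-; rewrite ltNge ltW.
have bn : b n = b 0%N (+) (l < 0) by exact: sgnE p0 pE.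
have bS k : (0 < k < n)%N -> b k.+1 = b k (+) (l < 0).
  by move=> kn; rewrite (sgnE _ _ _ (c0 k kn) (cE k kn)) addbK.
have [l0|l0] := boolP (l < 0); last first.
  have b1 k : (0 < k <= n)%N -> b k = b 1%N.
    elim: k => // k IH kn; have [->//|k0] := posnP k.
    by rewrite bS; [rewrite (negPf l0) addbF IH | ]; lia.
  have bc k : (k <= n)%N -> b k = b n.
    have [->|k0] := posnP k; first by rewrite bn (negPf l0) addbF.
    by move=> kn; rewrite !b1 //; lia.
  have bt i : odd (tau i) = b n by rewrite -(bc i) ?/b ?/t ?inord_val // -ltnS.
  have := bt ((tau^-1)%g (inord 0)); have := bt ((tau^-1)%g (inord 1)).
  by rewrite !permKV !inordK; [move=> <- | lia | lia].
rewrite l0 addbT in bn.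
(* The coefficient at [t 1%N] mixes [c 0%N] and [q], so the parity of [t 1%N] is instead traced back
   from [t n]. *)
have b1 k : (0 < k <= n)%N -> b k = ~~ odd k (+) b 1%N.
  elim: k => // k IH kn; have [->//|k0] := posnP k.
  rewrite bS; last by lia.
  by rewrite l0 IH; [rewrite /=; case: odd; case: b | lia].
have b10 : b 1%N = ~~ b 0%N by rewrite -bn (b1 n) ?n_odd //; lia.
move=> k kn; have [->//|k0] := posnP k.
by rewrite (b1 k) ?k0 // b10; case: odd; case: b.
Qed.

End CyclicImages.

(** A facet functional pairing [j] with an index of opposite parity other than [i] vanishes at [x i]
    but not at [x j]. *)
Lemma absorbs_genZ i j (a : R) : absorbs (a *: x i) (x j) -> j = i.
Proof.
move=> aij; apply/eqP; apply: contrapT => /negP ji.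
have [k [ok ki]] := other_index (~~ odd j) i.
have jk : j <~> k by rewrite ok; case: odd.
have f0 : facet j k (a *: x i) = 0.
  by rewrite facetZ facet_gen // ![i == _]eq_sym (negPf ji) (negPf ki) addr0 mulr0.
by have := boundary_absorbs jk f0 aij; rewrite eqxx.
Qed.

(** The labelling [tau] of the circuit preserves or exchanges the parities, hence induces an
    automorphism of [K]; in these labels [B] acts as [mu] times [A (q / mu)]. *)
Lemma exp_maximal_conjugate (A : R -> 'M[R]_n) (B : 'M[R]_n) :
  (forall alpha, 0 < alpha -> is_A_alpha x alpha (A alpha)) ->
  exp_maximal_mx K B ->
  exists (alpha c : R) (sigma : {perm 'I_n.+1}) (P Q : 'M[R]_n),
    [/\ 0 < alpha /\ 0 < c,
        (sigma @: odd_numbered n)%SET = odd_numbered n \/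
        (sigma @: odd_numbered n)%SET = even_numbered n,
        [/\ automorphism K P, automorphism K Q & Q *m P = 1%:M],
        forall j, P *m x j = x (sigma j)
      & B = c *: (Q *m A alpha *m P)].
Proof.
move=> A_def maxB.
have [prB [u slow]] := exp_maximal_slow ltr01 (A_def 1 ltr01) maxB.
have [piB _] := prB.
have [tau tu arcs] := extremal_digraph prB slow.
pose t k := tau (inord k).
have arcsE k l : (k <= n)%N -> (l <= n)%N -> walk B 1 (t k) (t l) <->
    l = k.+1 \/ (k = n /\ (l <= 1)%N).
  by move=> kn ln; rewrite arcs !inordK.
have tinv j : exists2 k, (k <= n)%N & j = t k.
  exists ((tau^-1)%g j); first by rewrite -ltnS.
  by rewrite /t inord_val permKV.
have stepB k : (k < n)%N -> exists2 d : R, 0 < d & B *m x (t k) = d *: x (t k.+1).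
  move=> kn; have [d d0 dE] : exists2 d : R, 0 <= d & B *m x (t k) = d *: x (t k.+1).
    apply: single_arc => // j; have [l ln ->] := tinv j.
    by move=> /arcsE[||->//|[]]; lia.
  exists d => //; rewrite lt_def d0 andbT; apply/eqP => d00.
  by have := primitive_gen_neq0 (t k) prB; rewrite dE d00 scale0r eqxx.
have /choice[c cP] : forall k : nat, exists d : R, (k < n)%N ->
    0 < d /\ B *m x (t k) = d *: x (t k.+1).
  move=> k; have [/stepB[d d0 dE]|] := ltnP k n; first by exists d.
  by exists 0.
have t01 : t 1%N != t 0%N.
  by rewrite (inj_eq perm_inj) -(inj_eq val_inj) /= !inordK //; lia.
have [p [q [p0 q0 pqE]]] : exists p q : R, [/\ 0 < p, 0 < q &
    B *m x (t n) = p *: x (t 0%N) + q *: x (t 1%N)].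
  have [d dP dE] := arc_gen (t n) piB.
  have {}dE : B *m x (t n) = d (t 0%N) *: x (t 0%N) + d (t 1%N) *: x (t 1%N).
    rewrite dE (bigD1 (t 0%N)) //= (bigD1 (t 1%N)) //= big1 ?addr0 // => j.
    have [l ln ->] := tinv j; move=> /andP[l0 l1].
    have [dl0 dl] := dP (t l); have [->|/dl] := eqVneq (d (t l)) 0.
      by rewrite scale0r.
    move=> /arcsE[//|//|lE|[_]]; first by lia.
    by case: l {ln dl0 dl} l0 l1 => [|[|//]]; rewrite eqxx.
  have t1 : walk B 1 (t n) (t 1%N) by apply/arcsE; lia.
  have t0 : walk B 1 (t n) (t 0%N) by apply/arcsE; lia.
  exists (d (t 0%N)), (d (t 1%N)); split=> //.
    (* With a zero coefficient the image of [x (t n)] would lie on one ray, and [t n] could not have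
       two out-arcs. *)
    have [d0 _] := dP (t 0%N); rewrite lt_def d0 andbT; apply/eqP => d00.
    move: t0; rewrite /walk expr1 dE d00 scale0r add0r => /absorbs_genZ/eqP.
    by rewrite eq_sym (negPf t01).
  have [d0 _] := dP (t 1%N); rewrite lt_def d0 andbT; apply/eqP => d00.
  move: t1; rewrite /walk expr1 dE d00 scale0r addr0 => /absorbs_genZ/eqP.
  by rewrite (negPf t01).
have cE k : (k < n)%N -> B *m x (t k) = c k *: x (t k.+1) by move=> /cP[].
have alt := positive_images_alternate cE pqE p0 (fun k kn => (cP k (proj2 (andP kn))).1).
have [mu [pmu c0mu cmu]] := alternating_images cE pqE alt.
have mu0 : 0 < mu by rewrite -pmu.
have parity j : odd (tau j) = odd j (+) odd (t 0%N).
  by have := alt j; rewrite /t inord_val; apply; rewrite -ltnS.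
have sgn_parity j : (-1) ^+ tau j = (-1) ^+ j * (-1) ^+ t 0%N :> R.
  by rewrite -signr_odd parity signr_addb !signr_odd.
have [Q QE] : exists Q : 'M[R]_n, forall i, Q *m x i = x (tau i).
  (* [tau] multiplies all signs by the constant [(-1) ^+ t 0%N], so the permuted generators still
     satisfy the relation. *)
  apply: linear_extension; apply: (scalerI (a := (-1) ^+ t 0%N)).
    by rewrite signr_eq0.
  rewrite scaler0 -[RHS]x_rel [RHS](reindex_inj (@perm_inj _ tau)) scaler_sumr.
  by apply: eq_bigr => i _; rewrite scalerA mulrC -sgn_parity.
have [P PE] : exists P : 'M[R]_n, forall i, P *m x i = x ((tau^-1)%g i).
  apply: linear_extension; rewrite (reindex_inj (@perm_inj _ tau)).
  under eq_bigr do rewrite permK sgn_parity mulrC -scalerA.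
  by rewrite -scaler_sumr x_rel scaler0.
have QP : Q *m P = 1%:M.
  by apply: mulmx_gen_ext => i; rewrite -mulmxA PE QE permKV mul1mx.
have PQ := mulmx1C QP.
have piQ : pi_cone K Q by apply/pi_coneP => i; rewrite QE; exact: K_gen.
have piP : pi_cone K P by apply/pi_coneP => i; rewrite PE; exact: K_gen.
have qmu0 : 0 < q / mu by rewrite divr_gt0.
have Aq := A_def _ qmu0.
exists (q / mu), mu, (tau^-1)%g, P, Q; split=> //.
- have oE (i : 'I_n.+1) : (i \in odd_numbered n) = ~~ odd i by rewrite finset.inE.
  have eE (i : 'I_n.+1) : (i \in even_numbered n) = odd i by rewrite finset.inE.
  have imE (i : 'I_n.+1) : (i \in ((tau^-1)%g @: odd_numbered n)%SET) = ~~ odd (tau i).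
    by rewrite -[X in X \in _](permK tau i) mem_imset ?oE //; exact: perm_inj.
  case: (boolP (odd (t 0%N))) => ot; [right | left]; apply/setP => i.
    by rewrite imE eE parity ot addbT negbK.
  by rewrite imE oE parity (negPf ot) addbF.
- by split; [exact: inverse_automorphism piP piQ QP
    | exact: inverse_automorphism piQ piP PQ | ].
- have Px k : P *m x (t k) = x (inord k) by rewrite PE /t permK.
  apply: mulmx_gen_ext => j; have [k kn ->] := tinv j.
  rewrite -scalemxAl -!mulmxA Px.
  have [->|kn'] := eqVneq k n.
    rewrite pqE (A_alpha_max Aq) mulmxDr -scalemxAr !QE scalerDr scalerA pmu.
    by rewrite mulrCA divff ?mulr1 // gt_eqF.
  have {}kn : (k < n)%N by lia.
  rewrite cE //; have [->|k0] := posnP k.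
    rewrite (A_alpha0 Aq) -scalemxAr QE scalerA c0mu.
    by rewrite mulrDr mulr1 mulrCA divff ?mulr1 // gt_eqF.
  by rewrite (A_alphaS Aq) ?k0 // QE cmu ?k0.
Qed.

(** * The face generated by A_alpha *)

Lemma gen_cases (P : 'I_n.+1 -> Prop) :
  P (inord 0) -> P (inord n) -> (forall k, (0 < k < n)%N -> P (inord k)) ->
  forall i, P i.
Proof.
move=> P0 Pn Pk i; rewrite -[i]inord_val.
have := ltn_ord i; rewrite ltnS leq_eqVlt => /predU1P[->//|lin].
by have [->//|i0] := posnP i; apply: Pk; rewrite i0.
Qed.

Lemma absorbs_ray i (c : R) y : K y -> absorbs (c *: x i) y ->
  exists2 p : R, 0 <= p & y = p *: x i.
Proof.
move=> /absorbs_gen[d dP yE] ciy; exists (d i); first by case: (dP i).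
rewrite [LHS]yE (bigD1 i) //= big1 ?addr0 // => j ji.
have [_ dj] := dP j; have [->|/dj yj] := eqVneq (d j) 0; first by rewrite scale0r.
by have /absorbs_genZ jE := absorbs_trans ciy yj; rewrite jE eqxx in ji.
Qed.

(** Every generator other than [x i] and [x j] is separated from both by a facet functional. *)
Lemma absorbs_facet2 i j (c d : R) y : i <~> j -> K y ->
  absorbs (c *: x i + d *: x j) y ->
  exists p q : R, [/\ 0 <= p, 0 <= q & y = p *: x i + q *: x j].
Proof.
move=> ij /absorbs_gen[r rP yE] cdy; exists (r i), (r j).
have [[ri0 _] [rj0 _]] := (rP i, rP j); split=> //.
have ji : j != i by apply: contraNneq ij => ->.
rewrite [LHS]yE (bigD1 i) //= (bigD1 j) //= big1 ?addr0 // => k /andP[ki kj].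
have [_ rk] := rP k; have [->|/rk yk] := eqVneq (r k) 0; first by rewrite scale0r.
have {yk}cdk := absorbs_trans cdy yk.
(* [l] has parity opposite to [k], so it need only avoid whichever of [i] and [j] has that
   parity. *)
have [l [ol li]] := other_index (~~ odd k) (if odd k == odd i then j else i).
have kl : k <~> l by rewrite ol; case: odd.
have [lni lnj] : i != l /\ j != l.
  move: ij ol li; have [ki'|ki'] := eqVneq (odd k) (odd i) => ij ol li.
    by split; [apply: contraNneq kl => <-; rewrite ki' | rewrite eq_sym].
  split; first by rewrite eq_sym.
  apply: contraNneq ki' => jl; move: ij; rewrite jl ol.
  by case: (odd k); case: (odd i).
have f0 : facet k l (c *: x i + d *: x j) = 0.
  rewrite facetD !facetZ !facet_gen // (negPf lni) (negPf lnj).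
  by rewrite ![_ == k]eq_sym (negPf ki) (negPf kj) !addr0 !mulr0 addr0.
by have := boundary_absorbs kl f0 cdk; rewrite eqxx.
Qed.

Section Pencil.
Variable A : R -> 'M[R]_n.
Hypothesis A_def : forall alpha, 0 < alpha -> is_A_alpha x alpha (A alpha).

(** [A] is specified at positive parameters only; since [A alpha] is affine in [alpha] there, [A0]
    is its extrapolation to 0 and [N] its slope. *)
Let A0 : 'M[R]_n := 2 *: A 1 - A 2.
Let N : 'M[R]_n := A 2 - A 1.

Let two_gt0 : 0 < 2 :> R. Proof. by []. Qed.

Let A0_0 : A0 *m x_[0] = x_[1].
Proof.
rewrite mulmxBl -scalemxAl (A_alpha0 (A_def ltr01)) (A_alpha0 (A_def two_gt0)).
by rewrite scalerA -scalerBl -[RHS]scale1r; congr (_ *: _); ring.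
Qed.

Let A0_S k : (0 < k < n)%N -> A0 *m x_[k] = x_[k.+1].
Proof.
move=> kn; rewrite mulmxBl -scalemxAl (A_alphaS (A_def ltr01)) //.
rewrite (A_alphaS (A_def two_gt0)) //.
by rewrite -{2}[x_[k.+1]]scale1r -scalerBl -[RHS]scale1r; congr (_ *: _); ring.
Qed.

Let A0_n : A0 *m x_[n] = x_[0].
Proof.
rewrite mulmxBl -scalemxAl (A_alpha_max (A_def ltr01)) (A_alpha_max (A_def two_gt0)).
rewrite scale1r scalerDr opprD addrACA subrr addr0.
by rewrite -{2}[x_[0]]scale1r -scalerBl -[RHS]scale1r; congr (_ *: _); ring.
Qed.

Let N_0 : N *m x_[0] = x_[1].
Proof.
rewrite mulmxBl (A_alpha0 (A_def ltr01)) (A_alpha0 (A_def two_gt0)).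
by rewrite -scalerBl -[RHS]scale1r; congr (_ *: _); ring.
Qed.

Let N_S k : (0 < k < n)%N -> N *m x_[k] = 0.
Proof.
move=> kn; rewrite mulmxBl (A_alphaS (A_def ltr01)) //.
by rewrite (A_alphaS (A_def two_gt0)) // subrr.
Qed.

Let N_n : N *m x_[n] = x_[1].
Proof.
rewrite mulmxBl (A_alpha_max (A_def ltr01)) (A_alpha_max (A_def two_gt0)).
rewrite opprD addrACA subrr add0r.
by rewrite -scalerBl -[RHS]scale1r; congr (_ *: _); ring.
Qed.

Let pencil (a b : R) : 'M[R]_n := a *: A0 + b *: N.

Let pencil_mul a b (y : 'cV[R]_n) : pencil a b *m y = a *: (A0 *m y) + b *: (N *m y).
Proof. by rewrite mulmxDl -!scalemxAl. Qed.

Let pencil_0 a b : pencil a b *m x_[0] = (a + b) *: x_[1].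
Proof. by rewrite pencil_mul A0_0 N_0 scalerDl. Qed.

Let pencil_S a b k : (0 < k < n)%N -> pencil a b *m x_[k] = a *: x_[k.+1].
Proof. by move=> kn; rewrite pencil_mul A0_S // N_S // scaler0 addr0. Qed.

Let pencil_n a b : pencil a b *m x_[n] = a *: x_[0] + b *: x_[1].
Proof. by rewrite pencil_mul A0_n N_n. Qed.

Let pencil_lin c a b a' b' :
  c *: pencil a b + pencil a' b' = pencil (c * a + a') (c * b + b').
Proof. by rewrite /pencil scalerDr !scalerA addrACA -!scalerDl. Qed.

Let pencilZ c a b : c *: pencil a b = pencil (c * a) (c * b).
Proof. by rewrite /pencil scalerDr !scalerA. Qed.

Lemma A_alpha_pencil alpha : 0 < alpha -> A alpha = pencil 1 alpha.
Proof.
move=> a0; apply: mulmx_gen_ext; apply: gen_cases => [||k kn].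
- by rewrite pencil_0 (A_alpha0 (A_def a0)).
- by rewrite pencil_n (A_alpha_max (A_def a0)) scale1r.
- by rewrite pencil_S // (A_alphaS (A_def a0)) // scale1r.
Qed.

Lemma pencil_pi a b : 0 <= a -> 0 <= b -> pi_cone K (pencil a b).
Proof.
move=> a0 b0; apply/pi_coneP; apply: gen_cases => [||k kn].
- by rewrite pencil_0; apply: KZ (K_gen _); exact: addr_ge0.
- by rewrite pencil_n; apply: KD; apply: KZ => //; exact: K_gen.
- by rewrite pencil_S //; apply: KZ => //; exact: K_gen.
Qed.

(** [M] sends each generator into the face generated by its image under the pencil, so it follows
    the same circuit and chord; the alternating relation then ties its coefficients together. *)
Lemma pencil_face a b M : pi_cone K M -> pi_cone K (pencil a b - M) ->
  exists a' b' : R, [/\ 0 <= a', 0 <= b' & M = pencil a' b'].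
Proof.
move=> piM piPM.
have dom i : absorbs (pencil a b *m x i) (M *m x i).
  exists 1 => //; rewrite scale1r -mulmxBl.
  by apply: pi_cone_mul => //; exact: K_gen.
have KM i : K (M *m x i) by apply: pi_cone_mul => //; exact: K_gen.
have /choice[c cE] : forall k : nat, exists d : R, (k < n)%N ->
    M *m x_[k] = d *: x_[k.+1].
  move=> k; have [kn|] := ltnP k n; last by exists 0.
  have [s sE] : exists s, pencil a b *m x_[k] = s *: x_[k.+1].
    have [->|k0] := posnP k; first by exists (a + b); rewrite pencil_0.
    by exists a; rewrite pencil_S ?k0.
  have := dom (inord k); rewrite sE => /(absorbs_ray (KM _))[d _ dE].
  by exists d.
have o01 : (inord 0 : 'I_n.+1) <~> (inord 1 : 'I_n.+1) by rewrite !inordK //; lia.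
have [p [q [p0 q0 pqE]]] : exists p q : R, [/\ 0 <= p, 0 <= q &
    M *m x_[n] = p *: x_[0] + q *: x_[1]].
  have := dom (inord n); rewrite pencil_n; exact: absorbs_facet2.
have [|||mu [pmu c0E cmu]] := @alternating_images M 1%g c p q.
- by move=> k kn; rewrite !perm1; exact: cE.
- by rewrite !perm1.
- by move=> k kn; rewrite !perm1 !inordK //= addbF.
exists mu, q; rewrite -{1}pmu; split=> //.
apply: mulmx_gen_ext; apply: gen_cases => [||k kn].
- by rewrite pencil_0 cE ?c0E //; lia.
- by rewrite pencil_n pqE pmu.
- by rewrite pencil_S // cE ?cmu //; lia.
Qed.

Let F : set 'M[R]_n :=
  [set M | exists a b : R, [/\ 0 <= a, 0 <= b & M = pencil a b]].

Lemma pencil_is_face : face (pi_cone K) F.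
Proof.
split; [split; [split|]|].
- by exists 0, 0; rewrite /pencil !scale0r addr0.
- move=> _ _ [a [b [a0 b0 ->]]] [a' [b' [a'0 b'0 ->]]].
  exists (1 * a + a'), (1 * b + b'); rewrite -pencil_lin scale1r.
  by split=> //; rewrite mul1r addr_ge0.
- move=> c _ c0 [a [b [a0 b0 ->]]]; exists (c * a), (c * b).
  by rewrite !mulr_ge0 // pencilZ.
- by move=> _ [a [b [a0 b0 ->]]]; exact: pencil_pi.
- by move=> _ M [a [b [a0 b0 ->]]]; exact: pencil_face.
Qed.

(** [A alpha] is the sum of [A0] and [alpha *: N], both in [pi_cone K], so every face containing it
    contains [A0] and [N]. *)
Lemma Phi_A_alpha alpha : 0 < alpha -> Phi (pi_cone K) (A alpha) = F.
Proof.
move=> a0; apply/seteqP; split.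
  apply: smallest_sub; first exact: pencil_is_face.
  by move=> _ ->; exists 1, alpha; rewrite (ltW a0) ler01 A_alpha_pencil.
move=> _ [a [b [age0 bge0 ->]]] G [[[[_ GD GZ] _] Gface] /(_ _ erefl) GA].
have GA0 : G A0.
  apply: Gface GA _ _.
    by have := pencil_pi ler01 (lexx 0); rewrite /pencil scale1r scale0r addr0.
  rewrite A_alpha_pencil // /pencil scale1r addrAC subrr add0r.
  by have := pencil_pi (lexx 0) (ltW a0); rewrite /pencil scale0r add0r.
have GN : G N.
  have -> : N = alpha^-1 *: (alpha *: N).
    by rewrite scalerA mulVf ?scale1r // gt_eqF.
  apply: GZ; first by rewrite invr_ge0 ltW.
  apply: Gface GA _ _.
    by have := pencil_pi (lexx 0) (ltW a0); rewrite /pencil scale0r add0r.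
  rewrite A_alpha_pencil // /pencil scale1r addrK.
  by have := pencil_pi ler01 (lexx 0); rewrite /pencil scale1r scale0r addr0.
by apply: GD; exact: GZ.
Qed.

(** Continuous linear functionals that recover [a] and [b] from [pencil a b]. *)
Let coord_a (M : 'M[R]_n) := facet (inord 2) (inord 3) (M *m x_[1]).
Let coord_b (M : 'M[R]_n) := facet (inord 1) (inord 2) (M *m x_[n]).

Let coord_aE a b : coord_a (pencil a b) = a.
Proof.
have o23 : (inord 2 : 'I_n.+1) <~> (inord 3 : 'I_n.+1) by rewrite !inordK //; lia.
rewrite /coord_a pencil_S; last by lia.
rewrite facetZ facet_gen // eqxx -(inj_eq val_inj) /= !inordK; [|lia|lia].
by rewrite addr0 mulr1.
Qed.

Let coord_bE a b : coord_b (pencil a b) = b.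
Proof.
have o12 : (inord 1 : 'I_n.+1) <~> (inord 2 : 'I_n.+1) by rewrite !inordK //; lia.
rewrite /coord_b pencil_n facetD !facetZ !facet_gen // -!(inj_eq val_inj) /=.
rewrite !inordK; [|lia..].
by rewrite /= !addr0 mulr0 mulr1 add0r.
Qed.

Let facet_mul_continuous i j (y : 'cV[R]_n) :
  continuous (fun M : 'M[R]_n => facet i j (M *m y)).
Proof.
apply: linear_form_continuous => [M M'|a M].
  by rewrite mulmxDl facetD.
by rewrite -scalemxAl facetZ.
Qed.

Let pencil_span a b : pencil a b \in <<[:: A0; N]>>%VS.
Proof.
rewrite span_cons span_seq1; apply: memv_add; apply: memvZ; exact: memv_line.
Qed.

Let span_pencil M : M \in <<[:: A0; N]>>%VS -> exists a b, M = pencil a b.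
Proof.
rewrite span_cons span_seq1 => /memv_addP[_ /vlineP[a ->] [_ /vlineP[b ->] ->]].
by exists a, b.
Qed.

Let linspan_F : [set` <<[:: A0; N]>>%VS] = linspan F.
Proof.
apply/seteqP; split=> M /=.
  move=> /span_pencil[a [b ->]] U FU; apply: memvD; apply: memvZ; apply: FU.
    by exists 1, 0; rewrite /pencil scale1r scale0r addr0.
  by exists 0, 1; rewrite /pencil scale1r scale0r add0r.
by apply=> _ [a [b [_ _ ->]]]; exact: pencil_span.
Qed.

Lemma has_dim_F : has_dim F 2.
Proof.
exists <<[:: A0; N]>>%VS; first exact: linspan_F.
apply/eqP; rewrite -/(free [:: A0; N]) free_cons seq1_free span_seq1.
have A0E : A0 = pencil 1 0 by rewrite /pencil scale1r scale0r addr0.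
have NE : N = pencil 0 1 by rewrite /pencil scale1r scale0r add0r.
apply/andP; split; last first.
  apply/eqP => N0; have := coord_bE 0 1; rewrite -NE N0 /coord_b mul0mx facet0.
  by move/eqP; rewrite eq_sym oner_eq0.
apply/negP => /vlineP[b bE]; have := coord_aE 0 b.
rewrite /pencil scale0r add0r -bE A0E coord_aE => /eqP.
by rewrite oner_eq0.
Qed.

Lemma relint_F : relint F =
  [set M | exists c beta : R, [/\ 0 < c, 0 < beta & M = c *: A beta]].
Proof.
apply/seteqP; split.
  (* Subtracting a small multiple of [pencil 1 1] lowers both coordinates at once, so both are
     positive at a relative interior point. *)
  move=> _ [[a [b [a0 b0 ->]]]] /(nbhs_pull (pencil 1 1))[e e0].
  have -> : pencil a b - e *: pencil 1 1 = pencil (a - e) (b - e).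
    by rewrite -scaleNr addrC pencil_lin !mulr1 ![- e + _]addrC.
  rewrite -linspan_F => /(_ (pencil_span _ _))[a' [b' [a'0 b'0 abE]]].
  have aE : a - e = a' by rewrite -(coord_aE (a - e) (b - e)) abE coord_aE.
  have bE : b - e = b' by rewrite -(coord_bE (a - e) (b - e)) abE coord_bE.
  have {}a0 : 0 < a by rewrite -[a](subrK e) aE ltr_wpDl.
  have {}b0 : 0 < b by rewrite -[b](subrK e) bE ltr_wpDl.
  exists a, (b / a); rewrite a0 divr_gt0 //; split=> //.
  rewrite A_alpha_pencil ?divr_gt0 // pencilZ mulr1 mulrCA.
  by rewrite divff ?mulr1 // gt_eqF.
move=> _ [c [beta [c0 beta0 ->]]].
have cE : c *: A beta = pencil c (c * beta).
  by rewrite A_alpha_pencil // pencilZ mulr1.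
have b0 : 0 < c * beta by rewrite mulr_gt0.
split; first by rewrite cE; exists c, (c * beta); rewrite !ltW.
rewrite cE -linspan_F.
have near_pos (phi : 'M[R]_n -> R) : continuous phi ->
    0 < phi (pencil c (c * beta)) ->
    \forall M \near pencil c (c * beta), 0 < phi M.
  by move=> cphi phi0; exact: (cphi _ _ (lt_nbhsr phi0)).
have na : \forall M \near pencil c (c * beta), 0 < coord_a M.
  by apply: near_pos; [exact: facet_mul_continuous | rewrite coord_aE].
have nb : \forall M \near pencil c (c * beta), 0 < coord_b M.
  by apply: near_pos; [exact: facet_mul_continuous | rewrite coord_bE].
near=> M => /span_pencil[a [b ME]]; exists a, b; split=> //.
  rewrite -(coord_aE a b) -ME; apply: ltW; near: M; exact: na.
rewrite -(coord_bE a b) -ME; apply: ltW; near: M; exact: nb.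
Unshelve. all: by end_near. Qed.

End Pencil.

(** * Similarity invariants *)

Lemma expmx_scale_mul (M : 'M[R]_n) (c : R) k (y : 'cV[R]_n) :
  (c *: M) ^+ k *m y = c ^+ k *: (M ^+ k *m y).
Proof.
elim: k => [|k IH]; first by rewrite !expmx0_mul scale1r.
by rewrite !expmxS_mul IH -scalemxAl -scalemxAr scalerA -exprS.
Qed.

Lemma expmx_conj_mul (M P : 'M[R]_n) k (y : 'cV[R]_n) : P \in unitmx ->
  (invmx P *m M *m P) ^+ k *m y = invmx P *m (M ^+ k *m (P *m y)).
Proof.
move=> PU; elim: k => [|k IH]; first by rewrite !expmx0_mul mulmxA mulVmx ?mul1mx.
by rewrite !expmxS_mul IH -!mulmxA (mulKVmx PU).
Qed.

Lemma scaled_A_alpha_annihil (alpha : R) (A : 'M[R]_n) (c : R) (y : 'cV[R]_n) :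
  0 < alpha -> is_A_alpha x alpha A ->
  (c *: A) ^+ n.+1 *m y =
  (alpha * c ^+ n) *: ((c *: A) *m y) + ((1 + alpha) * c ^+ n.+1) *: y.
Proof.
move=> a0 A_alpha; rewrite expmx_scale_mul (A_alpha_annihil a0 A_alpha).
rewrite mulmxDl mul_scalar_mx -!scalemxAl scalerDr !scalerA.
by congr (_ *: _ + _ *: _); rewrite ?exprSr; ring.
Qed.

(* By [scaled_A_alpha_annihil] the matrix c A satisfies X^(n+1) = d1 X + d0,
   where d1 = alpha c^n and d0 = (1 + alpha) c^(n+1) are determined because
   c A is not scalar. *)
Lemma similar_A_alpha (alpha1 alpha2 : R) (A1 A2 P : 'M[R]_n) (c1 c2 : R) :
  0 < alpha1 -> 0 < alpha2 -> is_A_alpha x alpha1 A1 -> is_A_alpha x alpha2 A2 ->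
  0 < c2 -> P \in unitmx -> invmx P *m (c1 *: A1) *m P = c2 *: A2 ->
  alpha1 * c1 ^+ n = alpha2 * c2 ^+ n /\
  (1 + alpha1) * c1 ^+ n.+1 = (1 + alpha2) * c2 ^+ n.+1.
Proof.
move=> a1 a2 A1E A2E c20 PU sim.
have simE (y : 'cV[R]_n) :
    invmx P *m ((c1 *: A1) *m (P *m y)) = (c2 *: A2) *m y.
  by rewrite -sim !mulmxA.
have := scaled_A_alpha_annihil c2 (x_[1]) a2 A2E.
rewrite -{1}sim expmx_conj_mul // (scaled_A_alpha_annihil _ _ a1 A1E).
rewrite mulmxDr -2!scalemxAr (mulKmx PU) simE.
rewrite -scalemxAl (A_alphaS A2E); last by lia.
set d1 := alpha1 * _; set d0 := _ * c1 ^+ n.+1.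
(* Both sides of [E] are combinations of [x_[2]] and [x_[1]]; the facet functional on indices 2, 3
   isolates the first coefficient and the one on 0, 1 the second. *)
move=> E; have o23 : (inord 2 : 'I_n.+1) <~> (inord 3 : 'I_n.+1).
  by rewrite !inordK //; lia.
have o01 : (inord 0 : 'I_n.+1) <~> (inord 1 : 'I_n.+1) by rewrite !inordK //; lia.
split.
  have := congr1 (facet (inord 2) (inord 3)) E.
  rewrite !facetD !facetZ !facet_gen // -!(inj_eq val_inj) /= !inordK; [|lia..].
  by rewrite /= !addr0 !mulr0 !mulr1 !addr0 => /(mulIf (lt0r_neq0 c20)).
have := congr1 (facet (inord 0) (inord 1)) E.
rewrite !facetD !facetZ !facet_gen // -!(inj_eq val_inj) /= !inordK; [|lia..].
by rewrite /= !add0r !mulr0 !mulr1 !add0r.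
Qed.

End AlternatingCone.

(** If [alpha1 < alpha2], the first identity gives [c2 < c1]. With s its common value, the second
    equates c(c^n + s) at [c1] and [c2], but this expression increases with c. *)
Lemma scaling_invariants_inj {R : realType} n (alpha1 alpha2 c1 c2 : R) :
  (0 < n)%N -> 0 < alpha1 -> 0 < alpha2 -> 0 < c1 -> 0 < c2 ->
  alpha1 * c1 ^+ n = alpha2 * c2 ^+ n ->
  (1 + alpha1) * c1 ^+ n.+1 = (1 + alpha2) * c2 ^+ n.+1 ->
  alpha1 = alpha2.
Proof.
move=> n0; wlog a12 : alpha1 alpha2 c1 c2 / alpha1 < alpha2.
  move=> wl a1 a2 c10 c20 E1 E0; have [lt|lt|//] := ltgtP alpha1 alpha2.
    exact: (wl _ _ c1 c2).
  by apply/esym/(wl _ _ c2 c1).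
move=> a1 a2 c10 c20 E1 E0; exfalso.
have cn : c2 ^+ n < c1 ^+ n.
  rewrite ltNge; apply/negP => le.
  have : alpha1 * c1 ^+ n < alpha2 * c2 ^+ n.
    by apply: (lt_le_trans (y := alpha2 * c1 ^+ n));
      [rewrite ltr_pM2r ?exprn_gt0 | rewrite ler_pM2l].
  by rewrite E1 ltxx.
have c12 : c2 < c1 by rewrite -(ltr_pXn2r n0) ?nnegrE ?ltW.
have : (1 + alpha2) * c2 ^+ n.+1 < (1 + alpha1) * c1 ^+ n.+1.
  rewrite !exprS ![(1 + _) * _]mulrCA !mulrDl !mul1r E1.
  apply: ltr_pM => //.
  - exact: ltW.
  - by rewrite addr_ge0 ?mulr_ge0 ?exprn_ge0 // ltW.
  - by rewrite ltrD2r.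
by rewrite E0 ltxx.
Qed.

Theorem theorem8p2 (R : realType) (n : nat) (n_ge3 : (3 <= n)%N)
    (n_odd : odd n) (K : set 'cV[R]_n) (K_minimal : minimal_cone K)
    (K_indec : indecomposable K) (K_expmax : exp_maximal_cone n.+1 K)
    (x : 'I_n.+1 -> 'cV[R]_n) (x_extreme : lists_extreme_vectors K x)
    (x_rel : alternating_relation x) (A : R -> 'M[R]_n)
    (A_def : forall alpha : R, 0 < alpha -> is_A_alpha x alpha (A alpha)) :
  [/\ (* each A alpha is indeed an exp-maximal K-primitive matrix *)
      forall alpha : R, 0 < alpha -> exp_maximal_mx K (A alpha),
      (* (i) *)
      [/\ forall alpha : R, 0 < alpha ->
            face (pi_cone K) (Phi (pi_cone K) (A alpha)) /\
            has_dim (Phi (pi_cone K) (A alpha)) 2,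
          forall alpha beta : R, 0 < alpha -> 0 < beta ->
            Phi (pi_cone K) (A alpha) = Phi (pi_cone K) (A beta)
        & forall alpha : R, 0 < alpha ->
            relint (Phi (pi_cone K) (A alpha)) =
            [set M | exists c beta : R,
                       [/\ 0 < c, 0 < beta & M = c *: A beta]]],
      (* (ii) *)
      forall B : 'M[R]_n, exp_maximal_mx K B ->
        exists alpha : R,
          [/\ 0 < alpha,
              exists2 c : R, 0 < c & cone_equivalent K B K (c *: A alpha)
            & exists (c : R) (sigma : {perm 'I_n.+1}) (P : 'M[R]_n),
                [/\ 0 < c,
                    (sigma @: odd_numbered n)%SET = odd_numbered n \/
                    (sigma @: odd_numbered n)%SET = even_numbered n,
                    automorphism K P,
                    forall j, P *m x j = x (sigma j)
                  & B = c *: (invmx P *m A alpha *m P)]]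
      (* (iii) *)
    & forall alpha1 alpha2 c1 c2 : R,
        0 < alpha1 -> 0 < alpha2 -> alpha1 != alpha2 -> 0 < c1 -> 0 < c2 ->
        ~ cone_equivalent K (c1 *: A alpha1) K (c2 *: A alpha2)].
Proof.
have Kproper : proper_cone K by case: K_minimal.
have Kint : K° !=set0 by case: Kproper.
have K_hull := proper_cone_conic_hull Kproper x_extreme.
have x_rel' := alternating_relationE x_rel.
split.
- move=> alpha a0.
  exact: (A_alpha_exp_maximal n_ge3 n_odd Kint K_hull x_rel' a0 (A_def _ a0)).
- split=> [alpha a0|alpha beta a0 b0|alpha a0].
  + rewrite (Phi_A_alpha n_ge3 n_odd Kint K_hull x_rel' A_def a0); split.
      exact: (pencil_is_face n_ge3 n_odd Kint K_hull x_rel' A_def).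
    exact: (has_dim_F n_ge3 n_odd Kint K_hull x_rel' A_def).
  + by rewrite !(Phi_A_alpha n_ge3 n_odd Kint K_hull x_rel' A_def).
  + rewrite (Phi_A_alpha n_ge3 n_odd Kint K_hull x_rel' A_def a0).
    exact: (relint_F n_ge3 n_odd Kint K_hull x_rel' A_def).
- move=> B maxB; have [piB _] : primitive K B by case: maxB => g [].
  have [alpha [c [sigma [P [Q [[a0 c0] sE [autP [QU QK] QP] PE BE]]]]]] :=
    exp_maximal_conjugate n_ge3 n_odd Kint K_hull x_rel' A_def maxB.
  have PQ := mulmx1C QP; have [PU _] := autP.
  have invP : invmx P = Q by rewrite -[RHS]mulmx1 -(mulmxV PU) mulmxA QP mul1mx.
  have invQ : invmx Q = P by rewrite -[RHS]mulmx1 -(mulmxV QU) mulmxA PQ mul1mx.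
  exists alpha; split=> //.
    exists c => //; split=> //.
      apply/(pi_coneP K_hull) => l; rewrite -scalemxAl.
      have [_ _ KZ] := K_cone K_hull; apply: KZ; first exact: ltW.
      have piA := A_alpha_pi K_hull a0 (A_def _ a0).
      exact: (pi_cone_mul piA (K_gen K_hull l)).
    (* The equivalence is given by [Q], the inverse of [P], since [B] is
       [c *: (Q *m A alpha *m P)]. *)
    exists Q; split=> //; rewrite invQ BE -scalemxAr -scalemxAl; congr (_ *: _).
    by rewrite !mulmxA PQ mul1mx -mulmxA PQ mulmx1.
  by exists c, sigma, P; split=> //; rewrite invP.
- move=> alpha1 alpha2 c1 c2 a1 a2 a12 c10 c20 [_ _ [P [PU _ sim]]].
  have [E1 E0] := similar_A_alpha n_ge3 n_odd Kint K_hull x_rel' a1 a2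
    (A_def _ a1) (A_def _ a2) c20 PU sim.
  move/eqP: a12; apply.
  by apply: (scaling_invariants_inj (n := n) (c1 := c1) (c2 := c2)) => //; lia.
Qed.
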